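(* Let $$f(z)=\sum_{m=1}^{M}b_m z^{-m}+\sum_{n=0}^{\infty}\frac{a_n}{n!}z^n$$ with complex coefficients $b_m,a_n$, and suppose there exists $p\in\mathbb{N}$ such that (1) $f\in\mathcal{T}^{(p-1)}_{-2\pi,0;2\pi,0}$; (2) $\lim_{t\to\infty}f^{(p)}(t+\mathrm{i}\xi)=0$ ($t$ real), locally uniformly in $\xi\in\mathbb{R}$; (3) $\sum_{n=0}^{\infty}(2\pi)^{-n}|a_n|<\infty$. Then for all $\alpha,\beta\in\mathbb{C}$ with $\mathrm{Re}\,\alpha,\mathrm{Re}\,\beta>-1$, $$(\mathrm{MS})\text{-}\sum_{k=\alpha+1}^{\beta}f(k)=\sum_{m=1}^{M}\left((\mathrm{MS})\text{-}\sum_{k=\alpha+1}^{\beta}b_m k^{-m}\right)+\sum_{n=0}^{\infty}\left((\mathrm{MS})\text{-}\sum_{k=\alpha+1}^{\beta}\frac{a_n}{n!}k^n\right).$$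
   Context: $\mathbb{N}=\{0,1,2,\dots\}$. All functions are considered on $\{z\in\mathbb{C}:\mathrm{Re}\,z>0\}$. **Müller–Schleicher (MS) fractional sum.** Let $U\subseteq\mathbb{C}$ with $U+1\subseteq U$ and $1\in U$, and $f:U\to\mathbb{C}$ (here $U=\{\mathrm{Re}\,z>0\}$). Suppose there is a sequence of polynomials $(P_n)_{n\in\mathbb{N}}$ such that: (i) the degrees of the $P_n$ are uniformly bounded; (ii) for all $y$ with $y+1\in U$ the limit $\lim_{n\to\infty}\left(\sum_{k=1}^n(f(k+y)-f(k))-P_n(y)\right)=:-Q(y)$ exists; (iii) for all $y$ with $y+1\in U$, $Q(y+1)-Q(y)=f(y+1)$. Then $(\mathrm{MS})\text{-}\sum_{k=x}^{y}f(k):=Q(y)-Q(x-1)$ for $x,y+1\in U$ (this does not depend on the choice of $(P_n)$). **The class $\mathcal{T}^{(p-1)}_{a,k;b,l}$.** It consists of the analytic functions $f$ on $\{\mathrm{Re}\,z>0\}$ such that: (1) for every $t\in\mathbb{C}$ with $\mathrm{Re}\,t>0$, $\xi\mapsto|f(t+\mathrm{i}\xi)|\mathrm{e}^{-b\xi}(1+|\xi|)^l$ is in $L^1(0,\infty)$, and $\lim_{\mathrm{Re}\,t\to\infty}\int_0^\infty\left|f(t+\mathrm{i}\xi)-\sum_{j=0}^{p-1}\frac{f^{(j)}(t)}{j!}(\mathrm{i}\xi)^j\right|\mathrm{e}^{-b\xi}(1+|\xi|)^l\,\mathrm{d}\xi=0$ locally uniformly with respect to $\mathrm{Im}\,t$;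 (2) for every $t\in\mathbb{C}$ with $\mathrm{Re}\,t>0$, $\xi\mapsto|f(t+\mathrm{i}\xi)|\mathrm{e}^{-a\xi}(1+|\xi|)^k$ is in $L^1(-\infty,0)$, and $\lim_{\mathrm{Re}\,t\to\infty}\int_{-\infty}^0\left|f(t+\mathrm{i}\xi)-\sum_{j=0}^{p-1}\frac{f^{(j)}(t)}{j!}(\mathrm{i}\xi)^j\right|\mathrm{e}^{-a\xi}(1+|\xi|)^k\,\mathrm{d}\xi=0$ locally uniformly with respect to $\mathrm{Im}\,t$; (3) there are $s\in\mathbb{R}$ and a locally bounded $C:(0,\infty)\to[0,\infty)$ with $|f(z)|\le C(\mathrm{Re}\,z)\mathrm{e}^{s|\mathrm{Im}\,z|}$. For $p=0$ the sums over $j$ are empty. *)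

(* Defs.v *)
From HB Require Import structures.
From mathcomp Require Import all_boot all_order all_algebra.
From mathcomp Require Import complex.
From mathcomp Require Import all_classical all_reals all_analysis.

Set Implicit Arguments.
Unset Strict Implicit.
Unset Printing Implicit Defensive.

Import Order.TTheory GRing.Theory Num.Theory.
Import numFieldNormedType.Exports.

Local Open Scope classical_set_scope.
Local Open Scope ring_scope.
Local Open Scope complex_scope.

(* R[i] packed as a numClosedFieldType, so that the topological and normed
   structures that MathComp-Analysis attaches to such types are inferred;
   they are not inferred on the bare type R[i]. *)
Definition Cplx (R : realType) : numClosedFieldType := R[i].

(* |z| as an element of R: the norm `|z| itself lives in Cplx R. *)
Definition modulus (R : realType) (z : Cplx R) : R := Normc.normc z.

Section Definitions.
Variable R : realType.
Local Notation C := (Cplx R).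

Definition right_half_plane : set C := [set z | 0 < complex.Re z].

Definition analytic_on (U : set C) (f : C -> C) : Prop :=
  forall z0, U z0 -> exists c : nat -> C,
    \forall z \near z0, series (fun n => c n * (z - z0) ^+ n) @ \oo --> f z.

(* F x y tends to 0 as x -> +oo, locally uniformly with respect to y in R *)
Definition cvg0_locally_uniformly (F : R -> R -> \bar R) : Prop :=
  forall y0 : R, exists2 V : set R, nbhs y0 V &
    forall e : R, 0 < e ->
      \forall x \near +oo, forall y, V y -> (`|F x y| < e%:E)%E.

(* f(t + i xi) - \sum_(j <= p - 1) f^(j)(t) / j! (i xi)^j; the sum is empty
   when p = 0 *)
Definition taylor_remainder (p : nat) (f : C -> C) (t : C) (xi : R) : C :=
  f (t + (0 +i* xi)) -
  \sum_(j < p) derive1n j f t / (j`!)%:R * (0 +i* xi) ^+ j.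

Definition weight (c l : R) (xi : R) : R :=
  expR (- (c * xi)) * (1 + `|xi|) `^ l.

Definition vertical_condition (p : nat) (D : set R) (c l : R) (f : C -> C) :
    Prop :=
  (forall t : C, right_half_plane t ->
     lebesgue_measure.-integrable D
       (fun xi : R => (modulus (f (t + (0 +i* xi))) * weight c l xi)%:E)) /\
  cvg0_locally_uniformly (fun x y : R =>
    (\int[lebesgue_measure]_(xi in D)
       (modulus (taylor_remainder p f (x +i* y) xi) * weight c l xi)%:E)%E).

Definition growth_condition (f : C -> C) : Prop :=
  exists (s : R) (B : R -> R),
    [/\ forall x, 0 < x -> 0 <= B x,
        [locally [bounded B x | x in (`]0, +oo[ : set R)]] &
        forall z : C, right_half_plane z ->
          modulus (f z) <= B (complex.Re z) * expR (s * `|complex.Im z|)].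

(* The class T^(p-1)_{a,k;b,l}: the first argument is p, not p - 1. *)
Definition class_T (p : nat) (a k b l : R) (f : C -> C) : Prop :=
  [/\ analytic_on right_half_plane f,
      vertical_condition p `]0, +oo[ b l f,
      vertical_condition p `]-oo, 0[ a k f &
      growth_condition f].

(* The polynomials P_n and the function Q realize the Mueller-Schleicher
   summability of f on U. The degree bound is expressed through size, i.e.
   degree + 1. *)
Definition MS_realizes (U : set C) (f : C -> C) (P : nat -> {poly C})
    (Q : C -> C) : Prop :=
  [/\ exists d : nat, forall n, (size (P n) <= d)%N,
      forall y, U (y + 1) ->
        (fun n : nat =>
           \sum_(1 <= k < n.+1) (f (k%:R + y) - f k%:R) - (P n).[y])
        @ \oo --> - Q y &
      forall y, U (y + 1) -> Q (y + 1) - Q y = f (y + 1)].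

Definition MS_summable (U : set C) (f : C -> C) : Prop :=
  exists P Q, MS_realizes U f P Q.

(* (MS)-\sum_(k = x)^y f(k) for x, y + 1 in U. The value Q y - Q (x - 1) does
   not depend on the choice of P (and hence Q), which is made by xget; the
   default 0 is only used if f is not MS-summable on U. *)
Definition MS_sum (U : set C) (f : C -> C) (x y : C) : C :=
  xget 0 [set S | exists P Q, MS_realizes U f P Q /\ S = Q y - Q (x - 1)].

End Definitions.

Arguments right_half_plane {R}.

(* Main.v *)
Require Import Defs.
From HB Require Import structures.
From mathcomp Require Import all_boot all_order all_algebra.
From mathcomp Require Import complex ring lra.
From mathcomp Require Import all_classical all_reals all_analysis.
From mathcomp Require Import measurable_realfun.

Set Implicit Arguments.
Unset Strict Implicit.
Unset Printing Implicit Defensive.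

Import Order.TTheory GRing.Theory Num.Theory.
Import numFieldNormedType.Exports.

Local Open Scope classical_set_scope.
Local Open Scope ring_scope.
Local Open Scope complex_scope.

(* Put [kappa x = 1 / (exp (2 pi x) + 1)]. The polynomial
   [S_n y = (y + 1/2)^(n+1) / (n+1)! + i int_0^oo
      ((y + 1/2 + i x)^n - (y + 1/2 - i x)^n) / n! * kappa x dx]
   (the midpoint Abel-Plana formula for [y^n / n!]) satisfies
   [S_n y - S_n (y - 1) = y^n / n!]. Since the moments of [kappa] are
   alternating zeta values, the case [y = 0] says that the Fourier series
   of [x^l] on [-1/2, 1/2], for [l > 0] even, sums to [0] at [0]; it follows from
   Fejer's theorem, and differentiation in [y] gives the other [y].

   The summability of [(2 pi)^-n |a_n|] makes [S y = sum a_n S_n y] converge,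
   and [S (y + 1) - S y] is the entire part of [f] at [y + 1]. The integral of
   the Taylor remainder in the class [T] bounds the difference between the
   integral part of [S] at [N + y] and a combination of the derivatives of
   order [< p] of the entire part; the derivative of order [p] tends to [0], so
   Taylor's formula at [N + 1/2] shows that [S (N + y) - S N] is a polynomial in
   [y] of degree at most [p], up to [o(1)]. Hence [S] plus the sums of the
   negative powers realizes the sum of [f]. The realizing function is unique
   up to a constant: a difference of two is constant on the naturals, and is
   a pointwise limit of polynomials of bounded degree. *)

(** The midpoint form is chosen because [1 / (exp (2 pi x) + 1)] is bounded at [0], whereas the
    kernel [1 / (exp (2 pi x) - 1)] of the endpoint form has a pole there. The number [2 pi] matters
    twice: the kernel is at most [exp (- 2 pi x)], the weight of the class [T], and its [j]-th
    moment is at most [j! / (2 pi)^(j+1)], so that [S_n y] is [O((2 pi)^-n)] for fixed [y], which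
    the hypothesis on [a_n] just absorbs. That estimate carries a factor [exp (2 pi |y|)], useless
    as [Re y] grows. It only removes the truncation of the power series at a fixed point; the decay
    to the right comes from the class [T] and from the [p]-th derivative. Both speak of [f], not of
    its entire part, so the negative powers, whose derivatives are all [O(1 / Re z)], are split off
    each time. The kernel integral is never applied to [f] itself: it is a linear functional on
    polynomials, a finite combination of moments, and is estimated at truncations. No complex-valued
    integral and no contour occurs; explicit primitives and subdivided segments take their place. *)

Section Modulus.
Variable R : realType.
Local Notation C := (Cplx R).
Implicit Types (z w : C) (x : R).

(** * The real-valued modulus *)

Lemma modulusE z : `|z| = (modulus z)%:C.
Proof. by []. Qed.

Lemma modulus_ge0 z : 0 <= modulus z.
Proof. by case: z => a b; exact: sqrtr_ge0. Qed.

Lemma modulus0 : modulus (0 : C) = 0.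
Proof. exact: Normc.normc0. Qed.

Lemma modulus1 : modulus (1 : C) = 1.
Proof. exact: Normc.normc1. Qed.

Lemma modulus_eq0 z : modulus z = 0 -> z = 0.
Proof. exact: Normc.eq0_normc. Qed.

Lemma modulusM z w : modulus (z * w) = modulus z * modulus w.
Proof. exact: Normc.normcM. Qed.

Lemma modulusV z : modulus z^-1 = (modulus z)^-1.
Proof. exact: Normc.normcV. Qed.

Lemma modulusD z w : modulus (z + w) <= modulus z + modulus w.
Proof. exact: le_normcD. Qed.

Lemma modulusN z : modulus (- z) = modulus z.
Proof. exact: normcN. Qed.

Lemma modulusBC z w : modulus (z - w) = modulus (w - z).
Proof. by rewrite -modulusN opprB. Qed.

Lemma modulusB z w : modulus (z - w) <= modulus z + modulus w.
Proof. by rewrite -(modulusN w) modulusD. Qed.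

Lemma modulusX z n : modulus (z ^+ n) = modulus z ^+ n.
Proof. by elim: n => [|n IH]; rewrite ?expr0 ?modulus1// !exprS modulusM IH. Qed.

Lemma modulus_real x : modulus (x%:C : C) = `|x|.
Proof. by rewrite /modulus /= expr0n /= addr0 sqrtr_sqr. Qed.

Lemma natrC n : (n%:R : C) = (n%:R : R)%:C.
Proof. by rewrite (rmorph_nat (real_complex R)). Qed.

Lemma modulus_nat n : modulus (n%:R : C) = n%:R.
Proof. by rewrite natrC modulus_real normr_nat. Qed.

Lemma modulus_sum (I : Type) (r : seq I) (P : pred I) (F : I -> C) :
  modulus (\sum_(i <- r | P i) F i) <= \sum_(i <- r | P i) modulus (F i).
Proof.
elim/big_rec2 : _ => [|i x y _ h]; first by rewrite modulus0.
by rewrite (le_trans (modulusD _ _))// lerD2l.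
Qed.

Lemma ler_Re_modulus z : `|complex.Re z| <= modulus z.
Proof. by have := normc_ge_Re z; rewrite lecR. Qed.

Lemma ler_Im_modulus z : `|complex.Im z| <= modulus z.
Proof.
case: z => a b /=; rewrite -sqrtr_sqr ler_wsqrtr// lerDr sqr_ge0 //.
Qed.

Lemma modulus_le_ReIm z : modulus z <= `|complex.Re z| + `|complex.Im z|.
Proof.
case: z => a b /=.
rewrite -(@ler_pXn2r _ 2)// ?nnegrE ?addr_ge0 ?sqrtr_ge0//.
rewrite sqr_sqrtr ?addr_ge0 ?sqr_ge0// sqrrD !real_normK ?num_real//.
by rewrite lerD2r lerDl mulrn_wge0// mulr_ge0.
Qed.

Lemma ReD z w : complex.Re (z + w) = complex.Re z + complex.Re w.
Proof. by case: z w => [a b] [c d]. Qed.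

Lemma ImD z w : complex.Im (z + w) = complex.Im z + complex.Im w.
Proof. by case: z w => [a b] [c d]. Qed.

Lemma ReN z : complex.Re (- z) = - complex.Re z.
Proof. by case: z => [a b]. Qed.

Lemma Re_real_mul x z : complex.Re ((x%:C : C) * z) = x * complex.Re z.
Proof. by case: z => [a b] /=; rewrite mul0r subr0. Qed.

Lemma Im_real_mul x z : complex.Im ((x%:C : C) * z) = x * complex.Im z.
Proof. by case: z => [a b] /=; rewrite mul0r addr0. Qed.

Lemma Re_nat n : complex.Re (n%:R : C) = n%:R.
Proof. by rewrite natrC. Qed.

Lemma Im_nat n : complex.Im (n%:R : C) = 0.
Proof. by rewrite natrC. Qed.

Lemma Re_sum (I : Type) (r : seq I) (P : pred I) (F : I -> C) :
  complex.Re (\sum_(i <- r | P i) F i) = \sum_(i <- r | P i) complex.Re (F i).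
Proof. by elim/big_rec2 : _ => // i x y _ <-; rewrite ReD. Qed.

Lemma Im_sum (I : Type) (r : seq I) (P : pred I) (F : I -> C) :
  complex.Im (\sum_(i <- r | P i) F i) = \sum_(i <- r | P i) complex.Im (F i).
Proof. by elim/big_rec2 : _ => // i x y _ <-; rewrite ImD. Qed.

(** The norm of [Cplx R] takes values in [Cplx R], whose order is partial. This equivalence moves
    convergence to real-valued functions, where squeezing applies. *)
Lemma cvgC_modulus (T : Type) (F : set_system T) (FF : Filter F)
    (u : T -> C) (l : C) :
  u @ F --> l <-> (fun t => modulus (u t - l)) @ F --> (0 : R).
Proof.
split=> [/cvgr_dist_lt h | /cvgr_dist_lt h].
- apply/cvgrPdist_lt => e e0.
  have e0' : 0 < (e%:C : C) by rewrite ltcR.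
  near=> t; rewrite sub0r normrN ger0_norm ?modulus_ge0//.
  have : `|l - u t| < e%:C by near: t; exact: h.
  by rewrite modulusE ltcR modulusBC.
- apply/cvgrPdist_lt => e e0.
  (* A positive element of [Cplx R] is a positive real, so the tolerance [e] may be replaced by its
     real part. *)
  have [eI eR] : complex.Im e = 0 /\ 0 < complex.Re e.
    by move: e0; rewrite ltcE => /andP[/eqP -> ->].
  near=> t.
  have : `|0 - modulus (u t - l)| < complex.Re e by near: t; exact: h.
  rewrite sub0r normrN ger0_norm ?modulus_ge0// => h1.
  by rewrite modulusE modulusBC ltcE /= eI eqxx.
Unshelve. all: by end_near. Qed.

Lemma modulus_cvgS (u : nat -> C) (v : nat -> R) (l : C) :
  (\forall n \near \oo, modulus (u n - l) <= v n) -> v @ \oo --> (0 : R) ->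
  u @ \oo --> l.
Proof.
move=> h hv; apply/cvgC_modulus.
apply: (@squeeze_cvgr _ _ _ _ (fun=> 0) v) => //; last exact: cvg_cst.
by near=> n; rewrite modulus_ge0/=; near: n.
Unshelve. all: by end_near. Qed.

Lemma cvgC_pair (u v : nat -> R) a b :
  u @ \oo --> a -> v @ \oo --> b ->
  (fun n => (u n +i* v n : C)) @ \oo --> (a +i* b : C).
Proof.
move=> ha hb; apply: (@modulus_cvgS _ (fun n => `|u n - a| + `|v n - b|)).
  by near=> n; exact: (modulus_le_ReIm ((u n +i* v n : C) - (a +i* b : C))).
rewrite -[X in _ --> X](addr0 0); apply: cvgD.
  by apply/norm_cvg0P/subr_cvg0.
by apply/norm_cvg0P/subr_cvg0.
Unshelve. all: by end_near. Qed.

End Modulus.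

Lemma cvg_congr (T : topologicalType) (u v : nat -> T) (l l' : T) :
  u =1 v -> l = l' -> u @ \oo --> l -> v @ \oo --> l'.
Proof. by move=> /funext -> ->. Qed.

Lemma cvg_sum (K : numFieldType) (V : normedModType K) (I : Type) (r : seq I)
    (F : I -> nat -> V) (l : I -> V) :
  (forall i, F i @ \oo --> l i) ->
  (fun n => \sum_(i <- r) F i n) @ \oo --> \sum_(i <- r) l i.
Proof.
move=> h; elim: r => [|i r IH].
  rewrite big_nil; under eq_fun do rewrite big_nil; exact: cvg_cst.
rewrite big_cons; under eq_fun do rewrite big_cons; exact: cvgD.
Qed.

(** * Uniqueness of Mueller-Schleicher sums *)

(** Dividing [r n - (r n).[x]] by ['X - x] removes one node and lowers the size by one, so induction
    on the nodes replaces Lagrange interpolation. *)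
Lemma poly_cvg0_points (K : numFieldType) (s : seq K) (r : nat -> {poly K}) :
  uniq s -> (forall n, size (r n) <= size s)%N ->
  (forall x, x \in s -> (r n).[x] @[n --> \oo] --> (0 : K)) ->
  forall y, (r n).[y] @[n --> \oo] --> (0 : K).
Proof.
elim: s r => [|x s IH] r /=.
  move=> _ hs _ y; rewrite (_ : (fun n => _) = fun=> 0); first exact: cvg_cst.
  by apply/funext => n; move: (hs n); rewrite leqn0 size_poly_eq0 => /eqP ->; rewrite horner0.
move=> /andP[xs us] hs hr y.
pose q n := (r n - (r n).[x]%:P) %/ ('X - x%:P).
have rE n : r n = (r n).[x]%:P + q n * ('X - x%:P).
  rewrite /q divpK ?subrKC// dvdp_XsubCl rootE !hornerE subrr//.
have rxy n z : (r n).[z] = (r n).[x] + (q n).[z] * (z - x).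
  by rewrite {1}rE !hornerE.
have rx0 : (r n).[x] @[n --> \oo] --> (0 : K) by apply: hr; rewrite mem_head.
have qy : (q n).[y] @[n --> \oo] --> (0 : K).
  apply: IH => //.
    move=> n; rewrite size_divp ?polyXsubC_eq0// size_XsubC /= leq_subLR add1n.
    rewrite (leq_trans (size_polyD _ _))// geq_max hs size_polyN.
    by rewrite (leq_trans (size_polyC_leq1 _)).
  move=> z zs.
  have zx : z - x != 0 by rewrite subr_eq0; apply: contraNneq xs => <-.
  apply: (@cvg_congr _ (fun n => ((r n).[z] - (r n).[x]) * (z - x)^-1) _ ((0 - 0) * (z - x)^-1)).
  - by move=> n; rewrite (rxy n z) addrC addKr mulfK.
  - by rewrite subr0 mul0r.
  by apply: cvgM; [apply: cvgB => //; apply: hr; rewrite inE zs orbT|exact: cvg_cst].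
apply: (@cvg_congr _ (fun n => (r n).[x] + (q n).[y] * (y - x)) _ (0 + 0 * (y - x))).
- by move=> n; rewrite (rxy n y).
- by rewrite mul0r addr0.
by apply: cvgD => //; apply: cvgM => //; exact: cvg_cst.
Qed.

Section MS.
Variable R : realType.
Local Notation C := (Cplx R).
Local Notation H := (@right_half_plane R).

Lemma MS_unique (f : C -> C) P Q P' Q' :
  MS_realizes H f P Q -> MS_realizes H f P' Q' ->
  forall x y, H (x + 1) -> H (y + 1) -> Q y - Q x = Q' y - Q' x.
Proof.
move=> [[d hd] hl hs] [[d' hd'] hl' hs'].
pose r n := P n - P' n.
have rD y : H (y + 1) -> (r n).[y] @[n --> \oo] --> Q y - Q' y.
  move=> Hy; apply: cvg_congr (cvgB (hl' _ Hy) (hl _ Hy)).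
    by move=> n; rewrite /r /= hornerD hornerN /= opprB addrC addrA subrK.
  by rewrite opprK addrC.
have Hk (k : nat) : H (k%:R + 1).
  by rewrite /right_half_plane /= natr1 natrC /= ltr0n.
have D0 (k : nat) : Q k%:R - Q' k%:R = Q 0 - Q' 0.
  elim: k => // k <-; have := hs' _ (Hk k); have := hs _ (Hk k); rewrite natr1.
  move=> /eqP; rewrite subr_eq => /eqP -> /eqP; rewrite subr_eq => /eqP ->.
  by rewrite opprD addrACA subrr add0r.
suff Dc y : H (y + 1) -> Q y - Q' y = Q 0 - Q' 0.
  move=> x y /Dc hx /Dc hy.
  move: hx hy => /eqP; rewrite subr_eq => /eqP -> /eqP; rewrite subr_eq => /eqP ->.
  by rewrite opprD addrACA subrr add0r.
(* The nodes are the first [m] naturals. The [1] in the maximum leaves room for the constant [c],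
   which may have size 1 even when [d = d' = 0]. *)
move=> Hy; pose c := Q 0 - Q' 0; pose m := (maxn 1 (maxn d d'))%N.
have : (r n - c%:P).[y] @[n --> \oo] --> (0 : C).
  apply: (@poly_cvg0_points _ [seq k%:R | k <- iota 0 m]).
  - rewrite map_inj_uniq ?iota_uniq// => i j /eqP.
    by rewrite eqr_nat => /eqP.
  - move=> n; rewrite size_map size_iota /r.
    rewrite (leq_trans (size_polyD _ _))// geq_max size_polyN; apply/andP; split.
      rewrite (leq_trans (size_polyD _ _))// size_polyN geq_max /m.
      rewrite !leq_max; apply/andP; split; apply/orP; right; apply/orP.
        by left; exact: hd.
      by right; exact: hd'.
    by rewrite (leq_trans (size_polyC_leq1 _))// /m leq_maxl.
  - move=> _ /mapP[k _ ->]; under eq_fun do rewrite hornerD hornerN hornerC.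
    rewrite -(subrr c); apply: cvgB; last exact: cvg_cst.
    by have := rD _ (Hk k); rewrite D0.
under eq_fun do rewrite hornerD hornerN hornerC.
move=> h; have h2 : (r n).[y] - c @[n --> \oo] --> Q y - Q' y - c.
  by apply: cvgB; [exact: rD|exact: cvg_cst].
have e : 0 = Q y - Q' y - c by apply: (cvg_unique _ h h2); exact: norm_hausdorff.
by apply/eqP; rewrite -subr_eq0 -e.
Qed.

(** [MS_sum] relies on an arbitrary choice of realization; uniqueness lets any realization at hand
    compute it. *)
Lemma MS_sumE (f : C -> C) P Q x y : MS_realizes H f P Q ->
  H x -> H (y + 1) -> MS_sum H f x y = Q y - Q (x - 1).
Proof.
move=> h Hx Hy; rewrite /MS_sum.
have [|P' [Q' [h' ->]]] := @xgetPex _ (0 : C)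
  [set S | exists P Q, MS_realizes H f P Q /\ S = Q y - Q (x - 1)].
  by exists (Q y - Q (x - 1)), P, Q.
by apply: (MS_unique h' h) => //; rewrite subrK.
Qed.

End MS.

(** * Dominated series of complex numbers *)

Section Series.
Variable R : realType.
Local Notation C := (Cplx R).

Lemma cvgC_series (u : nat -> C) (v : nat -> R) :
  (forall k, modulus (u k) <= v k) -> cvgn (series v) -> cvgn (series u).
Proof.
move=> uv cv.
have cRI (w : nat -> R) : (forall k, `|w k| <= v k) -> cvgn (series w).
  move=> wv; apply: normed_cvg; apply: (series_le_cvg _ _ wv cv) => k //=.
  by rewrite (le_trans _ (wv k)).
have cR : cvgn (series (fun k => complex.Re (u k))).
  by apply: cRI => k; apply: le_trans (ler_Re_modulus _) (uv k).
have cI : cvgn (series (fun k => complex.Im (u k))).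
  by apply: cRI => k; apply: le_trans (ler_Im_modulus _) (uv k).
have := cvgC_pair cR cI => h; apply: cvgP.
apply: cvg_congr h; last by reflexivity.
move=> n; rewrite /series /= -Re_sum -Im_sum.
by case: (\sum_(0 <= i < n) u i).
Qed.

Lemma modulus_lim_le (u : nat -> C) (l : C) (B : R) :
  u @ \oo --> l -> (forall n, modulus (u n) <= B) -> modulus l <= B.
Proof.
move=> /cvgC_modulus h uB.
apply/ler_addgt0Pr => e e0.
have [n] : exists n, `|modulus (u n - l)| < e.
  have /cvgrPdist_lt/(_ _ e0)[n _ hn] := h.
  by exists n; have := hn n (leqnn n); rewrite sub0r normrN.
rewrite ger0_norm ?modulus_ge0// => hn.
rewrite -[l](subrKC (u n)) (le_trans (modulusD _ _))// lerD ?uB//.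
by rewrite modulusBC ltW.
Qed.

Lemma series_tail_le (v : nat -> R) N n :
  (forall k, 0 <= v k) -> cvgn (series v) -> (N <= n)%N ->
  \sum_(N <= k < n) v k <= limn (series v) - series v N.
Proof.
move=> v0 cv Nn; rewrite -sub_series_geq// lerD2r.
by apply: nondecreasing_cvgn_le => //; exact: nondecreasing_series.
Qed.

Lemma modulus_series_tail (u : nat -> C) (v : nat -> R) N :
  (forall k, modulus (u k) <= v k) -> cvgn (series v) ->
  modulus (limn (series u) - series u N) <= limn (series v) - series v N.
Proof.
move=> uv cv; have cu := cvgC_series uv cv.
have v0 k : 0 <= v k by rewrite (le_trans _ (uv k)) ?modulus_ge0.
have h : (fun n => series u (n + N)%N - series u N) @ \oo --> limn (series u) - series u N.
  by apply: cvgB; [rewrite cvg_shiftn|exact: cvg_cst].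
apply: (modulus_lim_le h) => n.
rewrite sub_series_geq ?leq_addl// (le_trans (modulus_sum _ _ _))//.
rewrite (le_trans (ler_sum _ (fun i _ => uv i)))//.
by rewrite series_tail_le// leq_addl.
Qed.

Lemma cvgn_inv_pow2 (K : R) : cvgn (series (fun k : nat => K / k.+1%:R ^+ 2)).
Proof.
rewrite (_ : (fun k => _) = K *: (fun k => k.+1%:R ^- 2)); last by apply/funext.
apply: is_cvg_seriesZ.
(* The majorant is [2 / ((k + 1) (k + 2))], which telescopes; the factor 2 is needed already at
   [k = 0]. *)
apply: (@series_le_cvg _ _ (2 *: - telescope (@harmonic R))).
- by move=> n; rewrite invr_ge0 exprn_ge0.
- move=> n; rewrite /telescope /harmonic /= !fctE /=.
  rewrite /GRing.scale /= mulr_ge0// oppr_ge0 subr_le0 lef_pV2 ?posrE// ler_nat//.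
- move=> n; rewrite /telescope /harmonic /= !fctE /= /GRing.scale /= opprB.
  have h1 : (n.+1%:R : R) != 0 by rewrite pnatr_eq0.
  have h2 : (n.+2%:R : R) != 0 by rewrite pnatr_eq0.
  rewrite (_ : 2 * _ = n.+1%:R ^- 2 * (2 * n.+1%:R / n.+2%:R)); last first.
    by move: h1 h2; rewrite -!natr1 => h1 h2; field; rewrite h1 h2.
  rewrite ler_peMr ?invr_ge0 ?exprn_ge0// ler_pdivlMr// mul1r -natrM ler_nat.
  by rewrite mulSn mul1n addSn ltnS leq_addl.
- apply: is_cvg_seriesZ; rewrite is_cvg_seriesN telescopeK.
  apply: is_cvgB; last exact: is_cvg_cst.
  by apply/cvg_ex; exists 0; exact: cvg_harmonic.
Qed.

End Series.

(** * Sums of negative powers *)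

Section MSpowers.
Variable R : realType.
Local Notation C := (Cplx R).
Local Notation H := (@right_half_plane R).

(** For a summand that tends to [0] the zero polynomials suffice: replacing [y] by [y + 1]
    telescopes the partial sum, and the far boundary term [f (n + 1 + y)] disappears in the
    limit. *)
Lemma MS_realizes_of_cvg (f : C -> C) :
  (forall y, H (y + 1) -> f (n%:R + y) @[n --> \oo] --> (0 : C)) ->
  (forall y, H (y + 1) ->
    cvgn (fun n => \sum_(1 <= k < n.+1) (f (k%:R + y) - f k%:R))) ->
  MS_realizes H f (fun=> 0) (fun y =>
    - limn (fun n => \sum_(1 <= k < n.+1) (f (k%:R + y) - f k%:R))).
Proof.
move=> f0 fcvg; split.
- by exists 0%N => _; rewrite size_poly0.
- move=> y Hy; under eq_fun do rewrite horner0 subr0.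
  by rewrite opprK; exact: fcvg.
- move=> y Hy.
  have Hy1 : H (y + 1 + 1).
    by move: Hy; rewrite /right_half_plane /= !ReD => h; rewrite addr_gt0.
  pose s y n := \sum_(1 <= k < n.+1) (f (k%:R + y) - f k%:R).
  have e n : s (y + 1) n = s y n + (f (n.+1%:R + y) - f (y + 1)).
    rewrite [y + 1]addrC -(telescope_sumr (fun k => f (k%:R + y)) (isT : (1 <= n.+1)%N)).
    rewrite /s -big_split /=; apply: eq_bigr => k _.
    by rewrite [RHS]addrC [RHS]addrA subrK -natr1 addrA.
  have h : s (y + 1) @ \oo --> limn (s y) + (0 - f (y + 1)).
    apply: cvg_congr (fun n => esym (e n)) erefl _.
    apply: cvgD; first exact: fcvg.
    apply: cvgB; last exact: cvg_cst.
    have := f0 _ Hy; rewrite -cvg_shiftS; exact.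
  rewrite opprK addrC.
  rewrite -[LHS]/(limn (s y) - limn (s (y + 1))).
  rewrite (cvg_lim _ h)//.
  by rewrite opprD addNKr sub0r opprK.
Qed.

Lemma cvg_const_inv (K : R) : (fun n : nat => K / n.+1%:R) @ \oo --> (0 : R).
Proof.
apply: cvg_congr (cvgM (cvg_cst K) (@cvg_harmonic R)) => //; exact: mulr0.
Qed.

Lemma modulus_nat_add_ge (y : C) : H (y + 1) -> exists2 d : R, 0 < d <= 1 &
  forall n : nat, d * n.+1%:R <= modulus (n.+1%:R + y).
Proof.
rewrite /right_half_plane /= ReD /= => Hy.
(* If [d = Re y + 1] is below 1, then [Re (n + 1 + y) - d (n + 1) = (1 - d) n], which is
   nonnegative. *)
exists (Num.min 1 (complex.Re y + 1)).
  by rewrite lt_min ltr01 Hy ge_min lexx.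
move=> n; apply: le_trans (ler_Re_modulus _); apply: le_trans (ler_norm _).
rewrite ReD Re_nat.
have [h|h] := leP 1 (complex.Re y + 1).
  rewrite mul1r lerDl; lra.
rewrite -subr_ge0 (_ : _ - _ = (1 - (complex.Re y + 1)) * (n.+1%:R - 1)); last first.
  by rewrite -natr1; ring.
by rewrite mulr_ge0 ?subr_ge0 ?(ltW h)// ler1n.
Qed.

Lemma cvg_invpow_shift m (y : C) : (0 < m)%N -> H (y + 1) ->
  (n%:R + y) ^- m @[n --> \oo] --> (0 : C).
Proof.
case: m => // m _ /modulus_nat_add_ge[d /andP[d0 d1] hd]; rewrite -cvg_shiftS.
apply: (@modulus_cvgS _ _ (fun n => d ^- m.+1 / n.+1%:R)); last exact: cvg_const_inv.
near=> n; rewrite subr0 modulusV modulusX -exprVn.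
have n0 : 0 < n.+1%:R :> R by rewrite ltr0n.
have h1 : (modulus (n.+1%:R + y)) ^-1 <= d^-1 / n.+1%:R.
  by rewrite -invfM lef_pV2 ?posrE ?mulr_gt0// ?(lt_le_trans _ (hd n))// ?mulr_gt0// mulrC.
apply: le_trans (lerXn2r _ _ _ h1) _; rewrite ?nnegrE ?invr_ge0 ?modulus_ge0 ?mulr_ge0 ?invr_ge0 ?(ltW d0)//.
rewrite exprMn exprVn ler_wpM2l ?invr_ge0 ?exprn_ge0 ?(ltW d0)//.
rewrite exprS ler_piMr ?invr_ge0 ?(ltW n0)// exprn_ile1 ?invr_ge0 ?(ltW n0)//.
by rewrite invf_le1// ler1n.
Unshelve. all: by end_near. Qed.

Lemma modulus_subXX (a b : C) (L : R) m : modulus a <= L -> modulus b <= L ->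
  modulus (a ^+ m - b ^+ m) <= modulus (a - b) * (m%:R * L ^+ m.-1).
Proof.
move=> aL bL; have L0 : 0 <= L := le_trans (modulus_ge0 a) aL.
rewrite subrXX modulusM ler_wpM2l ?modulus_ge0//.
apply: le_trans (modulus_sum _ _ _) _.
apply: le_trans (ler_sum _ (G := fun=> L ^+ m.-1) _) _; last first.
  by rewrite sumr_const card_ord mulr_natl.
move=> i _; rewrite modulusM !modulusX.
have e : (m.-1 = (m.-1 - i) + i)%N.
  by rewrite subnK// -ltnS prednK ?ltn_ord// (leq_ltn_trans _ (ltn_ord i)).
rewrite [in leRHS]e.
by rewrite exprD ler_pM ?exprn_ge0 ?modulus_ge0//; apply: lerXn2r; rewrite ?nnegrE ?modulus_ge0.
Qed.

(** The reciprocals of [k + 1 + y] and [k + 1] differ by [- y] times their product, which is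
    [O(1 / (k + 1)^2)]; passing to [m]-th powers costs only a constant, as both are at most [1 / d].
    This covers [m = 1], where the two series diverge separately. *)
Lemma MS_realizes_invpow (c : C) m : (0 < m)%N ->
  exists Q, MS_realizes H (fun k => c * k ^- m) (fun=> 0) Q.
Proof.
move=> m0; eexists; apply: MS_realizes_of_cvg.
  move=> y Hy; apply: cvg_congr (cvgM (cvg_cst c) (cvg_invpow_shift m0 Hy)) => //.
  exact: mulr0.
move=> y Hy; have [d /andP[d0 d1] hd] := modulus_nat_add_ge Hy.
have L1 : 1 <= d^-1 by rewrite invf_ge1.
rewrite (_ : (fun n => _) =
  series (fun k => c * (k.+1%:R + y) ^- m - c * k.+1%:R ^- m)); last first.
  by apply/funext => n; rewrite /series /= big_add1.
apply: (@cvgC_series _ _ (fun k => modulus c * (modulus y / d * (m%:R * d^-1 ^+ m.-1)) / k.+1%:R ^+ 2));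
  last exact: cvgn_inv_pow2.
move=> k; rewrite -mulrBr modulusM -mulrA ler_wpM2l ?modulus_ge0//.
have k0 : 0 < k.+1%:R :> R by rewrite ltr0n.
have kV : (k.+1%:R : R)^-1 <= 1 by rewrite invf_le1// ler1n.
have w0 : 0 < modulus (k.+1%:R + y) by rewrite (lt_le_trans _ (hd k))// mulr_gt0.
have wV : (modulus (k.+1%:R + y))^-1 <= d^-1 / k.+1%:R.
  by rewrite -invfM lef_pV2 ?posrE ?mulr_gt0// mulrC.
rewrite -!exprVn; apply: le_trans (modulus_subXX _ (L := d^-1) _ _) _.
- rewrite modulusV (le_trans wV)// ler_piMr// invr_ge0 ltW//.
- by rewrite modulusV modulus_nat (le_trans kV).
have wn0 : k.+1%:R + y != 0.
  by apply: contraTneq w0 => ->; rewrite modulus0 ltxx.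
have kn0 : (k.+1%:R : C) != 0 by rewrite pnatr_eq0.
rewrite (_ : _^-1 - _^-1 = - y * ((k.+1%:R + y)^-1 * k.+1%:R^-1)); last first.
  have inv_sub (u v : C) : u != 0 -> v != 0 -> u^-1 - v^-1 = - (u - v) * (u^-1 * v^-1).
    by move=> u0 v0; field; rewrite u0 v0.
  by rewrite inv_sub// [_ + y]addrC addrK.
rewrite modulusM modulusN modulusM !modulusV modulus_nat.
rewrite [X in _ <= X](_ : _ = modulus y * (d^-1 / k.+1%:R / k.+1%:R) * (m%:R * d^-1 ^+ m.-1)); last first.
  by ring.
rewrite ler_wpM2r ?mulr_ge0// ?exprn_ge0 ?invr_ge0 ?(ltW d0)//.
by rewrite ler_wpM2l ?modulus_ge0// ler_wpM2r ?invr_ge0 ?(ltW k0).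
Qed.

End MSpowers.

(** * The kernel and its moments *)

Section Laplace.
Variable R : realType.
Local Notation mu := (@lebesgue_measure R).
Local Notation Rp := (`]0, +oo[%classic : set R).

Lemma is_derive_expRM (m x : R) :
  is_derive x 1 (fun y => expR (- m * y)) (- m * expR (- m * x)).
Proof.
have h : is_derive x 1 (fun y => - m * y) (- m).
  by apply: (is_derive_eq (is_deriveZ (- m) (is_derive_id x 1))); exact: mulr1.
apply: (is_derive_eq (@is_derive1_comp _ expR (fun y => - m * y) x _ _ (is_derive_expR _) h)).
exact: mulrC.
Qed.

Lemma is_derive_exprn (x : R) n :
  is_derive x 1 (fun y => y ^+ n) (n%:R * x ^+ n.-1).
Proof.
rewrite (_ : (fun y => y ^+ n) = (@id R) ^+ n); last by rewrite exprfctE.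
apply: (is_derive_eq (is_deriveX n (is_derive_id x 1))).
by case: n => [|n]; rewrite /GRing.scale /= mulr1 // mulr_natl.
Qed.

(* The primitive of [x^j exp (- m x)] that vanishes at [+oo]. *)
Fixpoint lap_prim (m : R) (j : nat) (x : R) : R :=
  if j is j'.+1 then
    - m^-1 * (x ^+ j * expR (- m * x)) + j%:R / m * lap_prim m j' x
  else - m^-1 * expR (- m * x).

Lemma is_derive_lap_prim (m x : R) j : m != 0 ->
  is_derive x 1 (lap_prim m j) (x ^+ j * expR (- m * x)).
Proof.
move=> m0; elim: j => [|j IH].
  apply: (is_derive_eq (is_deriveZ (- m^-1) (is_derive_expRM m x))).
  by rewrite /GRing.scale /= expr0 mul1r mulrA mulrNN mulVf// mul1r.
apply: (is_derive_eq (is_deriveD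
  (is_deriveZ (- m^-1) (is_deriveM (is_derive_exprn x j.+1) (is_derive_expRM m x)))
  (is_deriveZ (j.+1%:R / m) IH))).
rewrite /GRing.scale /=.
by field.
Qed.

Lemma cvg_expRM_pow (m : R) j : 0 < m ->
  x ^+ j * expR (- m * x) @[x --> +oo] --> (0 : R).
Proof.
(* [K / x] comes from keeping the single term [(m x)^(j+1) / (j+1)!] in the lower bound for
   [exp (m x)]. *)
move=> m0; pose K := j.+1`!%:R / m ^+ j.+1.
have V0 : x^-1 @[x --> (+oo : set_system R)] --> (0 : R).
  by apply/(gtr0_cvgV0 (f := @id R)); [exact: nbhs_pinfty_gt|exact: cvg_id].
apply: (@squeeze_cvgr _ _ _ _ (fun=> 0) (fun x => K * x^-1)); last first.
- by rewrite -(mulr0 K); apply: cvgM; [exact: cvg_cst|exact: V0].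
- exact: cvg_cst.
near=> x.
have x0 : 0 < x by near: x; exact: nbhs_pinfty_gt.
rewrite mulr_ge0 ?exprn_ge0 ?expR_ge0 ?(ltW x0)//=.
rewrite mulNr expRN ler_pdivrMr ?expR_gt0// mulrAC ler_pdivlMr//.
rewrite -exprSr.
have := expR_ge1Dxn j (mulr_ge0 (ltW m0) (ltW x0)); rewrite exprMn => h.
have {}h : (m ^+ j.+1 * x ^+ j.+1) / j.+1`!%:R <= expR (m * x).
  by apply: le_trans h; rewrite lerDr.
rewrite /K.
rewrite (_ : x ^+ j.+1 = j.+1`!%:R / m ^+ j.+1 * ((m ^+ j.+1 * x ^+ j.+1) / j.+1`!%:R)).
  by rewrite ler_wpM2l// divr_ge0// exprn_ge0// ltW.
field; rewrite expf_neq0 ?gt_eqF// ?ltr0n ?fact_gt0//.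
Unshelve. all: by end_near. Qed.

Lemma cvg_lap_prim (m : R) j : 0 < m -> lap_prim m j x @[x --> +oo] --> (0 : R).
Proof.
move=> m0; elim: j => [|j IH] /=.
  rewrite -(mulr0 (- m^-1)); apply: cvgM; first exact: cvg_cst.
  have := cvg_expRM_pow 0 m0; apply: cvg_trans; apply: near_eq_cvg.
  by near=> x; rewrite expr0 mul1r.
rewrite -(addr0 0) -{2}(mulr0 (j.+1%:R / m)) -{1}(mulr0 (- m^-1)).
apply: cvgD; apply: cvgM => //; try exact: cvg_cst.
exact: (@cvg_expRM_pow m j.+1).
Unshelve. all: by end_near. Qed.

Lemma lap_prim0 (m : R) j : m != 0 -> lap_prim m j 0 = - (j`!%:R / m ^+ j.+1).
Proof.
move=> m0; elim: j => [|j IH] /=; first by rewrite mulr0 expR0 mulr1 fact0 expr1 div1r.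
rewrite expr0n mul0r mulr0 add0r IH factS natrM [m ^+ j.+2]exprS.
by field; rewrite expf_neq0 ?m0.
Qed.

Lemma continuous_powexp (m : R) j : continuous (fun x : R => x ^+ j * expR (- m * x)).
Proof.
move=> x; apply: cvgM; first exact: exprn_continuous.
apply: (@continuous_comp _ _ _ (fun y => - m * y) expR); last exact: continuous_expR.
exact: mulrl_continuous.
Qed.

Lemma measurable_powexp (m : R) j (D : set R) :
  measurable_fun D (fun x : R => x ^+ j * expR (- m * x)).
Proof.
apply: measurable_funTS.
by apply: continuous_measurable_fun; exact: continuous_powexp.
Qed.

Lemma integral_powexp (m : R) j : 0 < m ->
  (\int[mu]_(x in Rp) (x ^+ j * expR (- m * x))%:E =
   (j`!%:R / m ^+ j.+1)%:E)%E.
Proof.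
move=> m0.
rewrite integral_itv_obnd_cbnd; last first.
  by apply/measurable_EFinP; exact: measurable_powexp.
rewrite (@ge0_continuous_FTC2y _ _ (lap_prim m j) _ 0).
- by rewrite -EFinD sub0r lap_prim0 ?gt_eqF// opprK.
- by move=> x x0; rewrite mulr_ge0 ?exprn_ge0 ?expR_ge0.
- exact/continuous_subspaceT/continuous_powexp.
- exact: cvg_lap_prim.
- by move=> x _; have [] := @is_derive_lap_prim m x j (lt0r_neq0 m0).
- apply: cvg_at_right_filter; apply: differentiable_continuous.
  apply/derivable1_diffP.
  by have [] := @is_derive_lap_prim m 0 j (lt0r_neq0 m0).
- move=> x _; rewrite derive1E.
  by have [_ ->] := @is_derive_lap_prim m x j (lt0r_neq0 m0).
Qed.

End Laplace.

Section Kernel.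
Variable R : realType.
Local Notation mu := (@lebesgue_measure R).
Local Notation Rp := (`]0, +oo[%classic : set R).

Definition fermi (x : R) : R := (expR (2 * pi * x) + 1)^-1.

Definition fermi_moment (j : nat) : R := \int[mu]_(x in Rp) (x ^+ j * fermi x).

Lemma mul2pi_gt0 : 0 < 2 * pi :> R.
Proof. by rewrite mulr_gt0 ?pi_gt0. Qed.

Lemma fermi_ge0 x : 0 <= fermi x.
Proof. by rewrite invr_ge0 addr_ge0 ?expR_ge0. Qed.

Lemma fermi_le x : fermi x <= expR (- (2 * pi) * x).
Proof.
rewrite mulNr expRN lef_pV2 ?posrE ?expR_gt0 ?ltr_wpDl ?expR_ge0//.
by rewrite lerDl.
Qed.

(** One step of the expansion of the kernel in powers of [exp (- 2 pi x)]. Stepwise use gives the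
    moments as alternating sums with an exact remainder, without exchanging a series and an
    integral. *)
Lemma fermi_rec x : fermi x = expR (- (2 * pi) * x) * (1 - fermi x).
Proof.
rewrite /fermi mulNr expRN.
field; rewrite ?gt_eqF ?expR_gt0 ?ltr_wpDl ?expR_ge0//.
Qed.

Lemma continuous_fermi : continuous fermi.
Proof.
move=> x; apply: cvgV; first by rewrite gt_eqF// ltr_wpDl ?expR_ge0.
apply: cvgD; last exact: cvg_cst.
apply: (@continuous_comp _ _ _ (fun y => 2 * pi * y) expR); last exact: continuous_expR.
exact: mulrl_continuous.
Qed.

Lemma integrable_powexp (m : R) j : 0 < m ->
  mu.-integrable Rp (fun x : R => (x ^+ j * expR (- m * x))%:E).
Proof.
move=> m0; apply/integrableP; split.
  by apply/measurable_EFinP; exact: measurable_powexp.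
rewrite [X in (X < _)%E](_ : _ = (j`!%:R / m ^+ j.+1)%:E) ?ltry//.
rewrite -integral_powexp//; apply: eq_integral => x.
rewrite inE /= in_itv /= andbT => x0.
by rewrite ger0_norm// mulr_ge0 ?exprn_ge0 ?expR_ge0// ltW.
Qed.

Lemma measurable_fermi (D : set R) : measurable_fun D fermi.
Proof.
apply: measurable_funTS; apply: continuous_measurable_fun; exact: continuous_fermi.
Qed.

Lemma integrable_pow_fermi (m : R) j : 0 <= m ->
  mu.-integrable Rp (fun x : R => (x ^+ j * expR (- m * x) * fermi x)%:E).
Proof.
move=> m0.
have : mu.-integrable Rp (fun x : R => (x ^+ j * expR (- (m + 2 * pi) * x))%:E).
  by apply: integrable_powexp; rewrite ltr_wpDl// mul2pi_gt0.
apply: le_integrable => //.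
  apply/measurable_EFinP; apply: measurable_funM; first exact: measurable_powexp.
  exact: measurable_fermi.
move=> x; rewrite /= in_itv /= andbT => x0.
rewrite lee_fin !ger0_norm ?mulr_ge0 ?exprn_ge0 ?expR_ge0 ?fermi_ge0 ?(ltW x0)//.
rewrite -mulrA ler_wpM2l ?exprn_ge0 ?(ltW x0)//.
by rewrite opprD mulrDl expRD ler_wpM2l ?expR_ge0// fermi_le.
Qed.

Lemma Rintegral_powexp (m : R) j : 0 < m ->
  \int[mu]_(x in Rp) (x ^+ j * expR (- m * x)) = j`!%:R / m ^+ j.+1.
Proof. by move=> m0; rewrite /Rintegral integral_powexp. Qed.

Let rest j N : R := \int[mu]_(x in Rp) (x ^+ j * expR (- (2 * pi * N%:R) * x) * fermi x).

Let rest0 j : rest j 0 = fermi_moment j.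
Proof.
rewrite /rest /fermi_moment; apply: eq_Rintegral => x _.
by rewrite mulr0 oppr0 mul0r expR0 mulr1.
Qed.

Let restS j N : rest j N = j`!%:R / (2 * pi * N.+1%:R) ^+ j.+1 - rest j N.+1.
Proof.
have N0 : 0 < 2 * pi * N.+1%:R :> R by rewrite mulr_gt0 ?mul2pi_gt0.
rewrite -Rintegral_powexp// /rest -RintegralB//=.
- apply: eq_Rintegral => x _; rewrite [in LHS]fermi_rec.
  rewrite (_ : - (2 * pi * N.+1%:R) * x = - (2 * pi * N%:R) * x + - (2 * pi) * x).
    by rewrite expRD; ring.
  by rewrite -[N.+1%:R]natr1; ring.
- exact: integrable_powexp.
- by apply: integrable_pow_fermi; exact: ltW.
Qed.

(** Since [rest j N] and [rest j N.+1] are both nonnegative, [restS] bounds each by the next term of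
    the expansion. The case [N = 0] bounds the moment; large [N] gives convergence. *)
Let rest_ge0 j N : 0 <= rest j N.
Proof.
apply: Rintegral_ge0 => x; rewrite /= in_itv /= andbT => /ltW x0.
by rewrite !mulr_ge0 ?exprn_ge0 ?expR_ge0 ?fermi_ge0.
Qed.

Lemma fermi_moment_ge0 j : 0 <= fermi_moment j.
Proof. by rewrite -rest0. Qed.

Lemma fermi_moment_le j : fermi_moment j <= j`!%:R / (2 * pi) ^+ j.+1.
Proof. by rewrite -rest0 restS mulr1 gerBl. Qed.

Let rest_le j N : rest j N <= j`!%:R / (2 * pi * N.+1%:R) ^+ j.+1.
Proof. by rewrite restS gerBl. Qed.

Let rest_sum j N : fermi_moment j =
  \sum_(0 <= i < N) (-1) ^+ i * (j`!%:R / (2 * pi * i.+1%:R) ^+ j.+1) + (-1) ^+ N * rest j N.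
Proof.
elim: N => [|N IH]; first by rewrite big_geq// add0r mul1r rest0.
rewrite {}IH big_nat_recr//= -addrA; congr (_ + _).
by rewrite restS [(-1) ^+ N.+1]exprS; ring.
Qed.

(** The bound on the remainder also covers [j = 0], where the alternating series is not absolutely
    convergent. *)
Lemma fermi_moment_series j :
  series (fun i => (-1) ^+ i / (2 * pi * i.+1%:R) ^+ j.+1) @ \oo -->
    fermi_moment j / j`!%:R.
Proof.
have jf : (j`!%:R : R) != 0 by rewrite gt_eqF// ltr0n fact_gt0.
have e N : series (fun i => (-1) ^+ i / (2 * pi * i.+1%:R) ^+ j.+1) N =
    fermi_moment j / j`!%:R - (-1) ^+ N * rest j N / j`!%:R :> R.
  rewrite (rest_sum j N) -mulrBl addrK mulr_suml; apply: eq_bigr => i _.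
  by rewrite [j`!%:R * _]mulrC !mulrA mulfK.
apply: cvg_congr (fun n => esym (e n)) (subr0 _) _.
apply: cvgB; first exact: cvg_cst.
apply/norm_cvg0P.
apply: (@squeeze_cvgr _ _ _ _ (fun=> 0) (fun N => (2 * pi) ^- j.+1 / N.+1%:R)); last first.
- exact: cvg_const_inv.
- exact: cvg_cst.
near=> N; rewrite normr_ge0/= !normrM normrX normrN normr1 expr1n mul1r.
rewrite ger0_norm// ger0_norm ?invr_ge0//.
rewrite ler_pdivrMr ?ltr0n ?fact_gt0//.
apply: le_trans (rest_le _ _) _.
rewrite [leRHS]mulrC ler_wpM2l// exprMn invfM ler_wpM2l//.
  by rewrite invr_ge0 exprn_ge0// ltW// mul2pi_gt0.
rewrite lef_pV2 ?posrE ?exprn_gt0//.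
by rewrite exprS ler_peMr// exprn_ege1// ler1n.
Unshelve. all: by end_near. Qed.

End Kernel.

(** * Fejer's theorem for even monomials *)

Section Fejer.
Variable R : realType.

Definition divpow (x : R) (l : nat) : R := x ^+ l / l`!%:R.

Lemma is_derive_divpow (x : R) l :
  is_derive x 1 (fun y => divpow y l.+1) (divpow x l).
Proof.
rewrite (_ : (fun y => _) = (l.+1`!%:R)^-1 \*: (fun y => y ^+ l.+1)); last first.
  by apply/funext => y; rewrite /divpow mulrC.
apply: (is_derive_eq (is_deriveZ (l.+1`!%:R)^-1 (is_derive_exprn x l.+1))).
rewrite /GRing.scale /divpow /= factS natrM.
have h2 : (l.+1%:R : R) != 0 by rewrite gt_eqF// ltr0n.
by rewrite invfM mulrACA mulVf// mul1r mulrC.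
Qed.

Lemma is_derive_sinM (m x : R) :
  is_derive x 1 (fun y => sin (m * y)) (m * cos (m * x)).
Proof.
have h : is_derive x 1 (fun y => m * y) m.
  by apply: (is_derive_eq (is_deriveZ m (is_derive_id x 1))); exact: mulr1.
apply: (is_derive_eq (@is_derive1_comp _ (@sin R) (fun y => m * y) x _ _ (is_derive_sin _) h)).
exact: mulrC.
Qed.

Lemma is_derive_cosM (m x : R) :
  is_derive x 1 (fun y => cos (m * y)) (- m * sin (m * x)).
Proof.
have h : is_derive x 1 (fun y => m * y) m.
  by apply: (is_derive_eq (is_deriveZ m (is_derive_id x 1))); exact: mulr1.
apply: (is_derive_eq (@is_derive1_comp _ (@cos R) (fun y => m * y) x _ _ (is_derive_cos _) h)).
by rewrite mulrC mulNr mulrN.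
Qed.

(** Primitives of [x^l / l! * cos (m x)] and [x^l / l! * sin (m x)], paired because each integration
    by parts turns one into the other. *)
Fixpoint trig_prim (m : R) (l : nat) (x : R) : R * R :=
  if l is l'.+1 then
    (divpow x l * (m^-1 * sin (m * x)) - m^-1 * (trig_prim m l' x).2,
     m^-1 * (trig_prim m l' x).1 - divpow x l * (m^-1 * cos (m * x)))
  else (m^-1 * sin (m * x), - (m^-1 * cos (m * x))).

Lemma is_derive_trig_prim (m x : R) l : m != 0 ->
  is_derive x 1 (fun y => (trig_prim m l y).1) (divpow x l * cos (m * x)) /\
  is_derive x 1 (fun y => (trig_prim m l y).2) (divpow x l * sin (m * x)).
Proof.
move=> m0; elim: l => [|l [IHc IHs]] /=.
  split.
    apply: (is_derive_eq (is_deriveZ m^-1 (is_derive_sinM m x))).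
    by rewrite /GRing.scale /divpow /= expr0 fact0 divr1; field.
  apply: (is_derive_eq (is_deriveN (is_deriveZ m^-1 (is_derive_cosM m x)))).
  by rewrite /GRing.scale /divpow /= expr0 fact0 divr1; field.
split.
  apply: (is_derive_eq (is_deriveB
    (is_deriveM (is_derive_divpow x l) (is_deriveZ m^-1 (is_derive_sinM m x)))
    (is_deriveZ m^-1 IHs))).
  by rewrite /= /GRing.scale /=; field.
apply: (is_derive_eq (is_deriveB (is_deriveZ m^-1 IHc)
    (is_deriveM (is_derive_divpow x l) (is_deriveZ m^-1 (is_derive_cosM m x))))).
by rewrite /= /GRing.scale /=; field.
Qed.

(* For [i > 0], the integral of [x^l / l! * cos (2 pi i x)] over [-1/2, 1/2]. *)
Definition cos_coef (l i : nat) : R :=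
  (trig_prim (2 * pi * i%:R) l 2^-1).1 - (trig_prim (2 * pi * i%:R) l (- 2^-1)).1.

Lemma sin_pin n : sin (pi * n%:R : R) = 0.
Proof.
elim: n => [|n IH]; first by rewrite mulr0 sin0.
by rewrite -natr1 mulrDr mulr1 sinDpi IH oppr0.
Qed.

Lemma cos_pin n : cos (pi * n%:R : R) = (-1) ^+ n.
Proof.
elim: n => [|n IH]; first by rewrite mulr0 cos0.
by rewrite -natr1 mulrDr mulr1 cosDpi IH exprS mulN1r.
Qed.

Lemma cos_coef0 i : cos_coef 0 i = 0.
Proof.
rewrite /cos_coef /=.
have -> : 2 * pi * i%:R * 2^-1 = pi * i%:R :> R by field.
have -> : 2 * pi * i%:R * - 2^-1 = - (pi * i%:R) :> R by field.
by rewrite sinN sin_pin oppr0 subrr.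
Qed.

(** Two integrations by parts: the sine boundary terms vanish because [sin (pi i) = 0], and the
    cosine ones contribute [(-1)^i]. *)
Lemma cos_coefSS l i : (0 < i)%N -> cos_coef l.+2 i =
  (2 * pi * i%:R) ^- 2 *
    ((-1) ^+ i * (divpow 2^-1 l.+1 - divpow (- 2^-1) l.+1) - cos_coef l i).
Proof.
move=> i0; rewrite /cos_coef /=.
have e1 : 2 * pi * i%:R * 2^-1 = pi * i%:R :> R by field.
have e2 : 2 * pi * i%:R * - 2^-1 = - (pi * i%:R) :> R by field.
rewrite e1 e2 sinN cosN sin_pin cos_pin.
have : (2 * pi * i%:R : R) != 0.
  by rewrite !mulf_neq0 ?pnatr_eq0 -?lt0n// gt_eqF// pi_gt0.
by move: (2 * pi * i%:R) => m m0; field.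
Qed.

(** The increment of a primitive stands for the integral over [[-1/2, 1/2]]. The interval has length
    1, so the mean value theorem passes the bounds on [f] to the increment unchanged. *)
Lemma derive_bound_increment (F f : R -> R) (B : R) :
  (forall x : R, is_derive x 1 F (f x)) ->
  (forall x, - 2^-1 <= x <= 2^-1 -> 0 <= f x <= B) ->
  0 <= F 2^-1 - F (- 2^-1) <= B.
Proof.
move=> dF fB.
have lt2 : - 2^-1 < 2^-1 :> R by lra.
have [|c c_in ->] := @MVT R F f _ _ lt2 (fun x _ => dF x).
  apply: continuous_subspaceT => x.
  by apply: differentiable_continuous; apply/derivable1_diffP; have [] := dF x.
have -> : 2^-1 - - 2^-1 = 1 :> R by lra.
rewrite mulr1; apply: fB; move: c_in; rewrite in_itv /= => /andP[h1 h2].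
by rewrite !ltW.
Qed.

Lemma sin_pi_sqr_ge (x : R) : - 2^-1 <= x <= 2^-1 -> x ^+ 2 <= sin (pi * x) ^+ 2.
Proof.
have cos2 (y : R) : 2 * cos y ^+ 2 = 1 + cos (2 * y).
  by rewrite [2 * y]mulr_natl cos_mulr2n [2 * _]mulr_natl; lra.
wlog x0 : x / 0 <= x => [H|] hx.
  have [x0|x0] := leP 0 x; first exact: H.
  rewrite -[x]opprK [sin _](_ : _ = - sin (pi * - x)); last by rewrite -sinN; congr sin; ring.
  rewrite sqrrN [leRHS]sqrrN; apply: H; lra.
have [->|xn0] := eqVneq x 0; first by rewrite mulr0 sin0 !expr0n.
have {xn0}x0 : 0 < x by rewrite lt0r xn0.
(* Halving the angle gives [sin (pi x) = 2 cos y sin y] with [sin y = y cos c], where [y] and [c]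
   are at most [pi / 4]. Both squared cosines are then at least [1/2], and [y >= x] since
   [pi >= 2]. *)
pose y : R := pi * x / 2.
have pg := pi_ge2 R.
have y0 : 0 < y by rewrite /y divr_gt0 ?mulr_gt0// pi_gt0.
have ypi : 2 * y <= pi / 2.
  rewrite /y; nra.
have [c c_in hc] := @MVT R (@sin R) (@cos R) _ _ y0 (fun x _ => is_derive_sin x)
   (continuous_subspaceT (@continuous_sin R)).
move: c_in; rewrite in_itv /= => /andP[c0 cy].
move: hc; rewrite sin0 !subr0 => hc.
have cc : 1 <= 2 * cos c ^+ 2.
  by rewrite cos2 lerDl cos_ge0_pihalf//; apply/andP; split; lra.
have cyy : 1 <= 2 * cos y ^+ 2.
  by rewrite cos2 lerDl cos_ge0_pihalf//; apply/andP; split; lra.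
have -> : sin (pi * x) = 2 * (cos y * sin y).
  by rewrite [2 * _]mulr_natl -sin_mulr2n; congr sin; rewrite /y; lra.
rewrite hc.
have -> : (2 * (cos y * (cos c * y))) ^+ 2 =
  (2 * cos y ^+ 2) * (2 * cos c ^+ 2) * y ^+ 2 by ring.
apply: (@le_trans _ _ (y ^+ 2)).
  rewrite ler_pXn2r ?nnegrE ?(ltW x0) ?(ltW y0)// /y; nra.
by rewrite ler_peMl ?sqr_ge0//; nra.
Qed.

Definition dirichlet (n : nat) (x : R) : R :=
  1 + 2 * \sum_(0 <= i < n) cos (2 * pi * i.+1%:R * x).

Lemma dirichlet_sin n x :
  dirichlet n x * sin (pi * x) = sin ((2 * n%:R + 1) * (pi * x)).
Proof.
rewrite /dirichlet; elim: n => [|n IH].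
  by rewrite big_geq// mulr0 addr0 mul1r; congr sin; ring.
rewrite big_nat_recr//= mulrDr addrA mulrDl IH.
set t := pi * x.
have -> : 2 * pi * n.+1%:R * x = (2 * n%:R + 1) * t + t by rewrite /t -natr1; ring.
have -> : (2 * n.+1%:R + 1) * t = ((2 * n%:R + 1) * t + t) + t by rewrite -natr1; ring.
set u := (2 * n%:R + 1) * t.
rewrite sinD.
have := cos2Dsin2 t; have := sinD u t; have := cosD u t => -> -> h.
have e : sin u = sin u * (cos t ^+ 2 + sin t ^+ 2) by rewrite h mulr1.
by rewrite {1}e; ring.
Qed.

(** The closed form of the Fejer kernel, multiplied out so that it also holds where
    [sin (pi x) = 0]. *)
Lemma fejer_sin N x :
  (\sum_(0 <= n < N) dirichlet n x) * sin (pi * x) ^+ 2 = sin (N%:R * (pi * x)) ^+ 2.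
Proof.
elim: N => [|N IH]; first by rewrite big_geq// mul0r mul0r sin0 expr0n.
rewrite big_nat_recr//= mulrDl IH.
rewrite (_ : dirichlet N x * _ = sin ((2 * N%:R + 1) * (pi * x)) * sin (pi * x)); last first.
  by rewrite -dirichlet_sin expr2 mulrA.
set t := pi * x.
have -> : (2 * N%:R + 1) * t = N%:R * t + (N%:R * t + t) by ring.
have -> : N.+1%:R * t = N%:R * t + t by rewrite -natr1; ring.
set u := N%:R * t.
rewrite !sinD !cosD.
move: (cos2Dsin2 t).
move: (sin u) (cos u) (sin t) (cos t) => su cu st ct ht.
apply/eqP; rewrite -subr_eq0; apply/eqP.
rewrite [LHS](_ : _ = su ^+ 2 * (1 - (ct ^+ 2 + st ^+ 2))); last by ring.
by rewrite ht subrr mulr0.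
Qed.

(* Jordan's inequality tames the pole of the Fejer kernel at [0]: on
   [-1/2, 1/2], [x^2] times the kernel is at most [1]. *)
Lemma fejer_bound N (x : R) l : - 2^-1 <= x <= 2^-1 -> ~~ odd l -> (0 < l)%N ->
  0 <= divpow x l * \sum_(0 <= n < N) dirichlet n x <= 1.
Proof.
move=> hx lev l0.
have [->|x0] := eqVneq x 0.
  by rewrite /divpow expr0n eqn0Ngt l0 !mul0r lexx ler01.
have x2 : 0 < x ^+ 2 by rewrite exprn_even_gt0.
have s2 := sin_pi_sqr_ge hx.
have s0 : 0 < sin (pi * x) ^+ 2 by rewrite (lt_le_trans x2).
set K := \sum_(0 <= n < N) _.
have KE : K = sin (N%:R * (pi * x)) ^+ 2 / sin (pi * x) ^+ 2.
  by rewrite -fejer_sin mulfK// gt_eqF.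
have K0 : 0 <= K by rewrite KE divr_ge0 ?sqr_ge0.
have Kx : x ^+ 2 * K <= 1.
  rewrite KE mulrA ler_pdivrMr// mul1r (le_trans _ s2)// ler_piMr ?sqr_ge0//.
have [k lk] : exists k, l = (k.*2).+2.
  exists (l./2).-1; rewrite -doubleS prednK; last by rewrite half_gt0; case: l lev l0 => [|[]].
  by rewrite -{1}(odd_double_half l) (negbTE lev).
have lE : divpow x l = x ^+ 2 * ((x ^+ 2) ^+ k / l`!%:R).
  by rewrite /divpow {1}lk -addn2 exprD -mul2n exprM; ring.
rewrite lE mulrAC.
have c0 : 0 <= (x ^+ 2) ^+ k / l`!%:R by rewrite divr_ge0 ?ler0n// exprn_ge0// sqr_ge0.
have c1 : (x ^+ 2) ^+ k / l`!%:R <= 1.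
  rewrite ler_pdivrMr ?ltr0n ?fact_gt0// mul1r (@le_trans _ _ 1)//; last by rewrite ler1n fact_gt0.
  rewrite exprn_ile1 ?sqr_ge0//; move: hx => /andP[h1 h2]; nra.
have xK0 : 0 <= x ^+ 2 * K by rewrite mulr_ge0 ?(ltW x2).
by rewrite mulr_ge0//= mulr_ile1.
Qed.

(** The partial sum at [0] of the Fourier series of [x^l / l!] on [[-1/2, 1/2]]: the difference is
    the mean value, and the factor 2 joins the frequencies [i + 1] and [- (i + 1)]. *)
Definition cos_partial (l n : nat) : R :=
  divpow 2^-1 l.+1 - divpow (- 2^-1) l.+1 + 2 * \sum_(0 <= i < n) cos_coef l i.+1.

Lemma cos_partial_mean_bound l N : ~~ odd l -> (0 < l)%N ->
  0 <= \sum_(0 <= n < N) cos_partial l n <= 1.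
Proof.
move=> lev l0.
(* [F] is a primitive of [x^l / l!] times the unnormalized Fejer kernel, assembled from the explicit
   primitives. *)
pose F (x : R) := \sum_(0 <= n < N) (divpow x l.+1 +
  2 * \sum_(0 <= i < n) (trig_prim (2 * pi * i.+1%:R) l x).1).
have dsum (n : nat) (g dg : nat -> R -> R) (x : R) :
    (forall i, is_derive x 1 (g i) (dg i x)) ->
    is_derive x 1 (fun y => \sum_(0 <= i < n) g i y) (\sum_(0 <= i < n) dg i x).
  move=> h; elim: n => [|n IH].
    rewrite big_geq//; under eq_fun do rewrite big_geq//.
    exact: is_derive_cst.
  rewrite big_nat_recr//=; under eq_fun do rewrite big_nat_recr//=.
  exact: is_deriveD.
have dF (x : R) : is_derive x 1 F (divpow x l * \sum_(0 <= n < N) dirichlet n x).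
  rewrite mulr_sumr; apply: (dsum N _ (fun n x => divpow x l * dirichlet n x)) => n.
  have h1 : is_derive x 1 (fun y => \sum_(0 <= i < n) (trig_prim (2 * pi * i.+1%:R) l y).1)
     (\sum_(0 <= i < n) divpow x l * cos (2 * pi * i.+1%:R * x)).
    apply: (dsum n _ (fun i x => divpow x l * cos (2 * pi * i.+1%:R * x))) => i.
    by have [] := @is_derive_trig_prim (2 * pi * i.+1%:R) x l (lt0r_neq0 _);
      rewrite ?mulr_gt0 ?pi_gt0 ?ltr0n.
  apply: (is_derive_eq (is_deriveD (is_derive_divpow x l) (is_deriveZ 2 h1))).
  by rewrite /GRing.scale /= /dirichlet -mulr_sumr; ring.
have := derive_bound_increment dF (fun x hx => fejer_bound N hx lev l0).
rewrite (_ : F 2^-1 - F (- 2^-1) = \sum_(0 <= n < N) cos_partial l n)//.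
rewrite /F -sumrB; apply: eq_bigr => n _.
rewrite /cos_partial /cos_coef sumrB; ring.
Qed.

(** A sum of [N] partial sums stays in [[0, 1]], so the Cesaro means vanish. Convergence of the
    partial sums themselves is assumed here; it will come from the expansion of the moments. *)
Lemma cos_partial_lim0 l (c : R) : ~~ odd l -> (0 < l)%N ->
  cos_partial l @ \oo --> c -> c = 0.
Proof.
move=> lev l0 /cesaro h.
have h0 : arithmetic_mean (cos_partial l) @ \oo --> (0 : R).
  apply: (@squeeze_cvgr _ _ _ _ (fun=> 0) (@harmonic R)); last 2 first.
  - exact: cvg_cst.
  - exact: cvg_harmonic.
  near=> n; rewrite /arithmetic_mean /series /= /harmonic.
  have /andP[s0 s1] := cos_partial_mean_bound n.+1 lev l0.
  by rewrite mulr_ge0//= ler_piMr.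
by apply: (cvg_unique _ h h0); exact: norm_hausdorff.
Unshelve. all: by end_near. Qed.

End Fejer.

(** * The summation polynomials *)

Section Appell.
Variable R : realType.
Local Notation C := (Cplx R).

(* [sgn_coef j = 'i ^ (j + 1) * (1 - (-1) ^ j)], a real number. *)
Fixpoint sgn_coef (j : nat) : R :=
  match j with 0 => 0 | 1 => -2 | j'.+2 => - sgn_coef j' end.

Lemma sgn_coefE j :
  ((sgn_coef j)%:C : C) = (0 +i* 1 : C) ^+ j.+1 * (1 - (-1) ^+ j).
Proof.
have i2 : (0 +i* 1 : C) ^+ 2 = -1 by rewrite expr2; apply/eqP; rewrite eq_complex /= !mul0r !mulr0 mulr1 addr0 sub0r oppr0 !eqxx.
have e : forall j, ((sgn_coef j)%:C : C) = (0 +i* 1 : C) ^+ j.+1 * (1 - (-1) ^+ j) /\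
   ((sgn_coef j.+1)%:C : C) = (0 +i* 1 : C) ^+ j.+2 * (1 - (-1) ^+ j.+1).
  elim=> [|{}j [h1 h2]].
    split; first by rewrite expr0 subrr mulr0.
    by rewrite i2 expr1 opprK mulN1r /= -[1 + 1]/2 natrC -rmorphN.
  split => //.
  rewrite -[j.+2.+1]addn2 exprD i2 mulrN1 -[X in (-1) ^+ X]addn2 [(-1) ^+ _]exprD sqrrN expr1n mulr1.
  rewrite mulNr -h1 -rmorphN //.
by have [] := e j.
Qed.

Lemma sgn_coef_even j : ~~ odd j -> sgn_coef j = 0.
Proof.
have e : forall j, ((~~ odd j -> sgn_coef j = 0) * (~~ odd j.+1 -> sgn_coef j.+1 = 0))%type.
  by elim=> [|{}j [h1 h2]]; split => //= h; rewrite h1 ?oppr0// -[odd j]negbK.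
by have [] := e j.
Qed.

Lemma norm_sgn_coef j : `|sgn_coef j| <= 2.
Proof.
have e : forall j, (`|sgn_coef j| <= 2) /\ (`|sgn_coef j.+1| <= 2).
  elim=> [|{}j [h1 h2]]; split => //=; last by rewrite normrN.
    by rewrite normr0.
  by rewrite ler_norml; apply/andP; split; lra.
by have [] := e j.
Qed.

(** With [B] the Bernoulli polynomials this is [B_(j+1)(1/2) / (j+1)!], the coefficient of [t^j] in
    [1 / (2 sinh (t/2)) - 1/t]. *)
Definition euler_coef (j : nat) : R := sgn_coef j * (fermi_moment R j / j`!%:R).

(** The Taylor coefficients of [2 sinh (t/2)]. *)
Let delta (l : nat) : R := divpow 2^-1 l - divpow (- 2^-1) l.

Let deltaE l : delta l = (1 - (-1) ^+ l) * divpow 2^-1 l.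
Proof. by rewrite /delta /divpow [(- 2^-1) ^+ l]exprNn -mulrA mulrBl mul1r. Qed.

Let delta_even l : ~~ odd l -> delta l = 0.
Proof. by move=> h; rewrite deltaE -signr_odd (negbTE h) subrr mul0r. Qed.

(* The contribution to [euler_coef j] of the [i]-th term of the expansion of
   [1 / (exp (2 pi x) + 1)] in powers of [exp (- 2 pi x)]. *)
Let trunc_coef (i j : nat) : R := sgn_coef j * ((-1) ^+ i / (2 * pi * i.+1%:R) ^+ j.+1).

Let conv (e : nat -> R) l := \sum_(j < l.+1) delta (l - j) * e j.

Let conv_trunc i l : ~~ odd l -> conv (trunc_coef i) l = 2 * cos_coef R l i.+1.
Proof.
move=> lev; rewrite -[l]odd_double_half (negbTE lev) add0n.
elim: (l./2) => [|k IH].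
  by rewrite /conv big_ord1 /trunc_coef /= mul0r mulr0 cos_coef0 mulr0.
(* Both sides obey the same two-step recursion. The term [j = 0] vanishes, [j = 1] with
   [sgn_coef 1 = -2] is the boundary term of [cos_coefSS], and the others reproduce the previous
   convolution with factor [- (2 pi (i + 1))^-2]. *)
rewrite doubleS cos_coefSS// {1}/conv big_ord_recl big_ord_recl /=.
rewrite {1}/trunc_coef /= mul0r mulr0 add0r.
have l0 : (2 * pi * i.+1%:R : R) != 0.
  by rewrite gt_eqF// !mulr_gt0 ?pi_gt0 ?ltr0n.
rewrite (eq_bigr (fun j : 'I_ _ => - (2 * pi * i.+1%:R) ^- 2 * (delta (k.*2 - j) * trunc_coef i j))); last first.
  move=> j _; rewrite /bump /= !add1n !subSS /trunc_coef /=.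
  rewrite -[j.+3]addn2 exprD invfM; ring.
rewrite -mulr_sumr -/(conv _ _) IH /bump /= addn0 subSS subn0 /trunc_coef /=.
rewrite -/(delta _) [(-1) ^+ i.+1]exprS.
by move: (2 * pi * i.+1%:R) l0 => m m0; field.
Qed.

(** The coefficient of [t^l] in [2 sinh (t/2) * (1/t + sum_j euler_coef j * t^j) = 1]. For odd [l]
    each product has a factor that vanishes by parity; for even [l > 0] the identity is the value at
    [0] of a Fourier series. *)
Lemma euler_identity l :
  delta l.+1 + \sum_(j < l.+1) delta (l - j) * euler_coef j = (l == 0%N)%:R.
Proof.
have [lo|lev] := boolP (odd l).
  rewrite delta_even ?negbK /= ?lo// add0r (_ : l == 0%N = false); last by case: l lo.
  apply: big1 => j _; have [jo|je] := boolP (odd j).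
    by rewrite delta_even ?mul0r// oddB ?lo ?jo// -ltnS.
  by rewrite /euler_coef sgn_coef_even// mul0r mulr0.
have [->|l0] := eqVneq l 0%N.
  rewrite big_ord1 /euler_coef /= mul0r mulr0 addr0 /delta /divpow !expr1 (_ : 1`! = 1%N)// !divr1 mulr1n; lra.
rewrite -lt0n in l0.
apply: (cos_partial_lim0 (R := R) lev l0).
(* Truncating the alternating series of every moment at the same [N] turns the left-hand side into
   [cos_partial l N], by [conv_trunc]. *)
rewrite (_ : cos_partial R l = fun N => delta l.+1 +
   \sum_(j < l.+1) delta (l - j) * (sgn_coef j *
      series (fun i => (-1) ^+ i / (2 * pi * i.+1%:R) ^+ j.+1) N)); last first.
  apply/funext => N; rewrite /cos_partial -/(delta _); congr (_ + _).
  rewrite mulr_sumr; under eq_bigr do rewrite -conv_trunc//.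
  rewrite /conv exchange_big /=; apply: eq_bigr => j _.
  by rewrite -mulr_sumr; congr (_ * _); rewrite /trunc_coef -mulr_sumr.
apply: cvgD; first exact: cvg_cst.
apply: cvg_sum => j; apply: cvgM; first exact: cvg_cst.
by apply: cvgM; [exact: cvg_cst|exact: fermi_moment_series].
Qed.

Lemma euler_coef_bound j : `|euler_coef j| <= 2 / (2 * pi) ^+ j.+1.
Proof.
have f0 : 0 < (j`!%:R : R) by rewrite ltr0n fact_gt0.
rewrite /euler_coef normrM ler_pM// ?norm_sgn_coef//.
rewrite ger0_norm ?divr_ge0 ?fermi_moment_ge0 ?ler0n//.
by rewrite ler_pdivrMr// mulrC fermi_moment_le.
Qed.

Definition appell (n : nat) : {poly C} :=
  \sum_(j < n.+1) ((euler_coef j)%:C / (n - j)`!%:R) *: 'X^(n - j).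

(** This is [B_(n+1)(z + 1/2) / (n+1)!] with [B_(n+1)] the Bernoulli polynomial; the [S_n y] of the
    overview is its value at [y + 1/2]. *)
Definition euler_poly (n : nat) : {poly C} :=
  (n.+1`!%:R)^-1 *: 'X^(n.+1) + appell n.

Lemma horner_appell n z :
  (appell n).[z] = \sum_(j < n.+1) (euler_coef j)%:C * (z ^+ (n - j) / (n - j)`!%:R).
Proof.
rewrite /appell horner_sum; apply: eq_bigr => j _.
by rewrite hornerZ hornerXn mulrAC mulrA.
Qed.

Lemma horner_euler_poly n z :
  (euler_poly n).[z] = z ^+ n.+1 / n.+1`!%:R + (appell n).[z].
Proof. by rewrite /euler_poly hornerD hornerZ hornerXn mulrC. Qed.

Lemma deriv_appell n : (appell n.+1)^`() = appell n.
Proof.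
rewrite /appell big_ord_recr /= subnn expr0 linearD /= linearZ /= derivC scaler0 addr0.
rewrite linear_sum /=; apply: eq_bigr => j _.
have jn : (j <= n)%N by rewrite -ltnS.
rewrite linearZ /= derivXn subSn//= -[_ *+ (n - j).+1]scaler_nat scalerA; congr (_ *: _).
rewrite factS natrM invfM -mulrA [_ * _ * (n - j).+1%:R]mulrAC mulVf ?mul1r// pnatr_eq0.
Qed.

Lemma deriv_euler_poly n : (euler_poly n.+1)^`() = euler_poly n.
Proof.
rewrite /euler_poly linearD /= deriv_appell linearZ /= derivXn -[_ *+ n.+2]scaler_nat scalerA.
congr (_ *: _ + _).
by rewrite factS natrM invfM mulrAC mulVf ?mul1r// pnatr_eq0.
Qed.

Lemma deriv_eq0_const (p : {poly C}) : p^`() = 0 -> p = (p.[0])%:P.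
Proof.
move=> p0; apply/polyP => -[|i]; rewrite coefC /= ?horner_coef0//.
have := congr1 (fun q : {poly C} => q`_i) p0; rewrite coef_deriv coef0 => /eqP.
by rewrite mulrn_eq0 /= => /eqP.
Qed.

Lemma real_divpow (x : R) k : ((divpow x k)%:C : C) = (x%:C : C) ^+ k / k`!%:R.
Proof. by rewrite /divpow rmorphM /= rmorphXn fmorphV rmorph_nat. Qed.

Lemma euler_poly_identity0 n :
  (euler_poly n).[2^-1] - (euler_poly n).[- 2^-1] = (n == 0%N)%:R.
Proof.
have e2 : (2^-1 : C) = (2^-1 : R)%:C by rewrite fmorphV rmorph_nat.
have e2N : (- 2^-1 : C) = (- 2^-1 : R)%:C by rewrite rmorphN e2.
have <- : (((n == 0%N)%:R : R)%:C : C) = (n == 0%N)%:R by rewrite rmorph_nat.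
rewrite -euler_identity !horner_euler_poly !horner_appell e2N e2 -!real_divpow.
rewrite opprD addrACA -rmorphB [RHS]rmorphD /=; congr (_ + _).
rewrite -sumrB rmorph_sum /=; apply: eq_bigr => j _.
by rewrite -!real_divpow -mulrBr -rmorphB -rmorphM mulrC.
Qed.

Lemma euler_poly_identity n z :
  (euler_poly n).[z + 2^-1] - (euler_poly n).[z - 2^-1] = z ^+ n / n`!%:R.
Proof.
pose D n := (euler_poly n \Po ('X + (2^-1)%:P)) - (euler_poly n \Po ('X + (- 2^-1)%:P))
  - (n`!%:R)^-1 *: 'X^n.
have DE k w : (D k).[w] = (euler_poly k).[w + 2^-1] - (euler_poly k).[w - 2^-1] - w ^+ k / k`!%:R.
  rewrite /D; move: (euler_poly k) => p.
  by rewrite !hornerD !hornerN !horner_comp !hornerD !hornerX !hornerC hornerZ hornerXn [_^-1 * _]mulrC.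
suff D0 : D n = 0.
  have := congr1 (fun p : {poly C} => p.[z]) D0.
  by rewrite DE horner0 => /eqP; rewrite subr_eq0 => /eqP.
have DC k : (D k).[0] = 0.
  rewrite DE !add0r euler_poly_identity0 expr0n.
  by case: k => [|k] /=; rewrite ?mul0r ?subrr// divr1 subrr.
have d1 (c : C) : ('X + c%:P)^`() = 1 by rewrite derivD derivX derivC addr0.
have dX0 : ('X^1 : {poly C})^`() = 1 by rewrite expr1 derivX.
elim: n => [|n IH]; rewrite (deriv_eq0_const (p := D _)) ?DC//.
  have E0 : (euler_poly 0)^`() = 1.
    rewrite /euler_poly /appell big_ord1 /= subnn expr0 derivD !derivZ dX0.
    by rewrite -polyC1 derivC scaler0 addr0 invr1 scale1r.
  rewrite /D !derivB !deriv_comp E0 !d1 !mulr1 -!polyC1 !comp_polyC subrr.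
  by rewrite derivZ expr0 -polyC1 derivC scaler0 subr0.
rewrite -IH /D !derivB !deriv_comp !deriv_euler_poly !d1 !mulr1.
rewrite derivZ derivXn -[_ *+ n.+1]scaler_nat scalerA factS natrM invfM.
by rewrite mulrAC mulVf ?mul1r// pnatr_eq0.
Qed.

End Appell.

(** * Exponential generating functions *)

Section Qderiv.
Variable R : realType.
Local Notation C := (Cplx R).

(* A quantitative form of [u' = v], uniform on bounded sets. It yields Taylor's
   formula by subdividing a segment, without complex integration. *)
Definition qderiv (u v : C -> C) := forall r : R, exists K : R, forall z k : C,
  modulus z <= r -> modulus k <= r ->
  modulus (u (z + k) - u z - k * v z) <= K * modulus k ^+ 2.

Lemma qderiv_ext u v u' v' : u =1 u' -> v =1 v' -> qderiv u v -> qderiv u' v'.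
Proof. by move=> /funext -> /funext ->. Qed.

Lemma qderiv_cst (c : C) : qderiv (fun=> c) (fun=> 0).
Proof.
by move=> r; exists 0 => z k _ _; rewrite subrr mulr0 subr0 modulus0 mul0r.
Qed.

Lemma qderivD u v u' v' : qderiv u v -> qderiv u' v' ->
  qderiv (fun z => u z + u' z) (fun z => v z + v' z).
Proof.
move=> h h' r; have [K hK] := h r; have [K' hK'] := h' r.
exists (K + K') => z k hz hk.
rewrite mulrDl [X in modulus X](_ : _ = (u (z + k) - u z - k * v z) + (u' (z + k) - u' z - k * v' z)).
  by apply: le_trans (modulusD _ _) _; apply: lerD; [exact: hK|exact: hK'].
ring.
Qed.

Lemma qderivZ (c : C) u v : qderiv u v -> qderiv (fun z => c * u z) (fun z => c * v z).
Proof.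
move=> h r; have [K hK] := h r; exists (modulus c * K) => z k hz hk.
rewrite [X in modulus X](_ : _ = c * (u (z + k) - u z - k * v z)); last by ring.
by rewrite modulusM -mulrA ler_wpM2l ?modulus_ge0// hK.
Qed.

Lemma qderivB u v u' v' : qderiv u v -> qderiv u' v' ->
  qderiv (fun z => u z - u' z) (fun z => v z - v' z).
Proof.
move=> h h'; apply: qderiv_ext (qderivD h (qderivZ (-1) h')) => z /=; by rewrite mulN1r.
Qed.

Lemma qderiv_shift (c : C) u v : qderiv u v ->
  qderiv (fun z => u (c + z)) (fun z => v (c + z)).
Proof.
move=> h r; have [K hK] := h (modulus c + r); exists K => z k hz hk.
rewrite addrA; apply: hK.
  by rewrite (le_trans (modulusD _ _))// lerD2l.
by rewrite (le_trans hk)// lerDr modulus_ge0.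
Qed.

Lemma qderiv_sum n (u v : nat -> C -> C) : (forall i, qderiv (u i) (v i)) ->
  qderiv (fun z => \sum_(i < n) u i z) (fun z => \sum_(i < n) v i z).
Proof.
move=> h; elim: n => [|n IH].
  by apply: qderiv_ext (qderiv_cst 0) => z; rewrite big_ord0.
by apply: qderiv_ext (qderivD IH (h n)) => z; rewrite big_ord_recr.
Qed.

(** The factor [(n + 2) (n + 1)] is the one that division by [(n + 2)!] reduces to [1 / n!], so that
    these bounds later sum to an exponential. *)
Lemma powD_bound (z k : C) (r : R) n : modulus z + modulus k <= r ->
  modulus ((z + k) ^+ n.+2 - z ^+ n.+2 - n.+2%:R * (k * z ^+ n.+1)) <=
  (n.+2 * n.+1)%:R * (modulus k ^+ 2 * r ^+ n).
Proof.
move=> hr.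
have r0 : 0 <= r by rewrite (le_trans _ hr)// addr_ge0 ?modulus_ge0.
have zr : modulus z <= r by rewrite (le_trans _ hr)// lerDl modulus_ge0.
elim: n => [|n IH].
  rewrite [X in modulus X](_ : _ = k ^+ 2); last by ring.
  by rewrite modulusX expr0 mulr1 ler_peMl ?sqr_ge0// ler1n.
rewrite [X in modulus X](_ : _ = (z + k) * ((z + k) ^+ n.+2 - z ^+ n.+2 - n.+2%:R * (k * z ^+ n.+1))
   + n.+2%:R * (k ^+ 2 * z ^+ n.+1)); last first.
  rewrite [(z + k) ^+ n.+3]exprS [z ^+ n.+3]exprS [z ^+ n.+2]exprS -[n.+3%:R]natr1; ring.
apply: le_trans (modulusD _ _) _.
rewrite !modulusM !modulusX modulus_nat.
apply: (@le_trans _ _ (r * ((n.+2 * n.+1)%:R * (modulus k ^+ 2 * r ^+ n)) +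
   n.+2%:R * (modulus k ^+ 2 * r ^+ n.+1))).
  apply: lerD.
    apply: ler_pM => //; rewrite ?modulus_ge0//.
    exact: le_trans (modulusD _ _) hr.
  rewrite ler_wpM2l// ler_wpM2l ?mulr_ge0 ?modulus_ge0//.
  by apply: lerXn2r; rewrite ?nnegrE ?modulus_ge0.
rewrite [leLHS](_ : _ = (n.+2 * n.+2)%:R * (modulus k ^+ 2 * r ^+ n.+1)); last first.
  rewrite !natrM [r ^+ n.+1]exprS -[n.+2%:R]natr1; ring.
rewrite ler_wpM2r ?mulr_ge0 ?exprn_ge0 ?modulus_ge0// ler_nat.
exact: leq_mul.
Qed.

Lemma modulus_fact n : modulus (n`!%:R : C)^-1 = (n`!%:R)^-1.
Proof. by rewrite modulusV modulus_nat. Qed.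

Lemma divpowD_bound (z k : C) (r : R) n : modulus z + modulus k <= r ->
  modulus ((z + k) ^+ n.+2 / n.+2`!%:R - z ^+ n.+2 / n.+2`!%:R - k * (z ^+ n.+1 / n.+1`!%:R)) <=
  modulus k ^+ 2 * (r ^+ n / n`!%:R).
Proof.
move=> hr.
have e1 : (n.+1`!%:R : C)^-1 = (n.+2`!%:R)^-1 * n.+2%:R.
  by rewrite [n.+2`!]factS natrM invfM mulrAC mulVf ?mul1r// pnatr_eq0.
have e2 : (n.+2`!%:R : R)^-1 * (n.+2 * n.+1)%:R = (n`!%:R)^-1.
  by rewrite !factS mulnA natrM invfM mulrAC mulVf ?mul1r// pnatr_eq0.
rewrite e1 [X in modulus X](_ : _ = (n.+2`!%:R)^-1 *
  ((z + k) ^+ n.+2 - z ^+ n.+2 - n.+2%:R * (k * z ^+ n.+1))); last first.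
  by move: (_^-1) n.+2%:R => F N; ring.
rewrite modulusM modulus_fact.
apply: le_trans (ler_wpM2l _ (powD_bound n hr)) _; first by rewrite invr_ge0.
by rewrite [leLHS]mulrA e2 mulrCA [r ^+ n * _]mulrC.
Qed.

Lemma qderiv_divpow n : qderiv (fun z => z ^+ n.+1 / n.+1`!%:R) (fun z => z ^+ n / n`!%:R).
Proof.
move=> r; case: n => [|n].
  exists 0 => z k _ _; rewrite (_ : 1`! = 1%N)// fact0 !expr1 expr0 !divr1 mulr1.
  by rewrite [X in modulus X](_ : _ = 0) ?modulus0 ?mul0r//; ring.
exists ((r + r) ^+ n / n`!%:R) => z k hz hk.
by rewrite [leRHS]mulrC; apply: divpowD_bound; rewrite lerD.
Qed.

(** Over [N + 1] equal steps the linear terms add up to at most [e |y|], and the quadratic errors to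
    [K |y|^2 / (N + 1)], which vanishes in the limit. *)
Lemma qderiv_mean_value (w v : C -> C) (y : C) (e : R) : qderiv w v -> w 0 = 0 ->
  (forall s : R, 0 <= s <= 1 -> modulus (v (s%:C * y)) <= e) ->
  modulus (w y) <= e * modulus y.
Proof.
move=> wv w0 ve; have [K hK] := wv (modulus y).
pose p N i : C := ((i%:R / N.+1%:R : R)%:C : C) * y.
have pb N i : (i <= N.+1)%N -> 0 <= (i%:R / N.+1%:R : R) <= 1.
  move=> iN; apply/andP; split; first by rewrite divr_ge0 ?ler0n.
  by rewrite ler_pdivrMr ?ltr0n// mul1r ler_nat.
have step N i : (i < N.+1)%N ->
    modulus (w (p N i.+1) - w (p N i)) <=
      modulus y / N.+1%:R * e + K * (modulus y / N.+1%:R) ^+ 2.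
  move=> iN; pose k : C := ((N.+1%:R^-1 : R)%:C : C) * y.
  have kE : modulus k = modulus y / N.+1%:R.
    by rewrite modulusM modulus_real ger0_norm ?invr_ge0// mulrC.
  have pS : p N i.+1 = p N i + k.
    by rewrite /p /k -mulrDl -rmorphD /= -natr1 mulrDl mul1r.
  have hp : modulus (p N i) <= modulus y.
    have /andP[h1 h2] := pb N i (ltnW iN).
    by rewrite modulusM modulus_real ger0_norm// ler_piMl ?modulus_ge0.
  have hk : modulus k <= modulus y.
    by rewrite kE ler_piMr ?modulus_ge0// invf_le1// ler1n.
  have := hK _ _ hp hk; rewrite -pS kE => h.
  rewrite -[w (p N i.+1) - _](subrK (k * v (p N i))).
  apply: le_trans (modulusD _ _) _; rewrite addrC lerD// modulusM kE.
  rewrite ler_wpM2l ?mulr_ge0 ?modulus_ge0 ?invr_ge0//.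
  by apply: ve; apply: pb; exact: ltnW.
have bound N : modulus (w y) <= e * modulus y + K * modulus y ^+ 2 / N.+1%:R.
  have -> : w y = \sum_(0 <= i < N.+1) (w (p N i.+1) - w (p N i)).
    rewrite telescope_sumr// /p divff ?pnatr_eq0// mul1r.
    by rewrite mul0r mul0r w0 subr0.
  apply: le_trans (modulus_sum _ _ _) _.
  apply: (@le_trans _ _ (\sum_(0 <= i < N.+1)
     (modulus y / N.+1%:R * e + K * (modulus y / N.+1%:R) ^+ 2))).
    by apply: ler_sum_nat => i /andP[_ iN]; exact: step.
  rewrite sumr_const_nat subn0 -[_ *+ N.+1]mulr_natl.
  have N0 : (N.+1%:R : R) != 0 by rewrite pnatr_eq0.
  by move: (N.+1%:R : R) N0 => x x0; rewrite le_eqVlt; apply/orP; left; apply/eqP; field.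
have lim : (fun N : nat => e * modulus y + K * modulus y ^+ 2 / N.+1%:R) @ \oo -->
    e * modulus y.
  rewrite -[X in _ --> X]addr0; apply: cvgD; first exact: cvg_cst.
  exact: cvg_const_inv.
rewrite -(cvg_lim _ lim)//.
by apply: limr_ge; [apply/cvg_ex; exists (e * modulus y)|apply: nearW].
Qed.

(** The remainder of order [q + 1] of [u 0] vanishes at [0], and its derivative is the remainder of
    order [q] of [u 1]. The classical [1 / q!] is given up, since [e] will be arbitrarily small. *)
Lemma qderiv_taylor q (u : nat -> C -> C) (c y : C) (e : R) : 0 <= e ->
  (forall j, qderiv (u j) (u j.+1)) ->
  (forall s : R, 0 <= s <= 1 -> modulus (u q (c + s%:C * y)) <= e) ->
  forall s : R, 0 <= s <= 1 ->
  modulus (u 0 (c + s%:C * y) - \sum_(i < q) u i c * ((s%:C * y) ^+ i / i`!%:R)) <=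
    e * modulus y ^+ q.
Proof.
move=> e0; elim: q u => [|q IH] u hu hq s hs.
  by rewrite big_ord0 subr0 mulr1; exact: hq.
have {}IH := IH (fun j => u j.+1) (fun j => hu j.+1) hq.
pose w (x : C) := u 0 (c + x) - \sum_(i < q.+1) u i c * (x ^+ i / i`!%:R).
pose v (x : C) := u 1 (c + x) - \sum_(i < q) u i.+1 c * (x ^+ i / i`!%:R).
have wv : qderiv w v.
  apply: qderivB; first exact: qderiv_shift.
  have h := qderivD (qderiv_cst (u 0 c))
    (qderiv_sum q (fun i => qderivZ (u i.+1 c) (qderiv_divpow i))).
  apply: qderiv_ext h => x; last by rewrite add0r.
  by rewrite big_ord_recl /= expr0 fact0 divr1 mulr1.
have w0 : w 0 = 0.
  rewrite /w addr0 big_ord_recl /= expr0 fact0 divr1 mulr1 big1 ?addr0 ?subrr//.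
  by move=> i _; rewrite expr0n /= mul0r mulr0.
have /andP[s0 s1] := hs.
have h : modulus (w (s%:C * y)) <= e * modulus y ^+ q * modulus (s%:C * y).
  apply: (qderiv_mean_value wv w0) => t /andP[t0 t1].
  rewrite mulrA -rmorphM; apply: IH.
  by rewrite mulr_ge0//= mulr_ile1.
apply: le_trans h _; rewrite exprSr mulrA ler_wpM2l//.
  by rewrite mulr_ge0// exprn_ge0 ?modulus_ge0.
by rewrite modulusM modulus_real ger0_norm// ler_piMl ?modulus_ge0.
Qed.

End Qderiv.

Section Egf.
Variable R : realType.
Local Notation C := (Cplx R).

Definition egf (a : nat -> C) (z : C) : C :=
  limn (series (fun n => a n / n`!%:R * z ^+ n)).

Definition exp_bounded (lam : R) (a : nat -> C) :=
  exists2 A : R, 0 <= A & forall n, modulus (a n) <= A * lam ^+ n.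

Lemma exp_bounded_shift lam a : 0 <= lam -> exp_bounded lam a ->
  exp_bounded lam (fun n => a n.+1).
Proof.
move=> l0 [A A0 hA]; exists (A * lam); first by rewrite mulr_ge0.
by move=> n; rewrite -mulrA -exprS.
Qed.

Lemma exp_bounded_unshift lam a : 0 < lam -> exp_bounded lam a ->
  exp_bounded lam (fun n => if n is m.+1 then a m else 0).
Proof.
move=> l0 [A A0 hA]; exists (A / lam); first by rewrite divr_ge0 ?(ltW l0).
case=> [|n]; first by rewrite modulus0 mulr1 divr_ge0 ?(ltW l0).
by rewrite exprS mulrA divfK ?gt_eqF.
Qed.

Lemma cvgn_exp_coeffZ (A x : R) : cvgn (series (fun n => A * exp_coeff x n)).
Proof.
rewrite (_ : (fun n => _) = A *: exp_coeff x); last by apply/funext.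
by apply: is_cvg_seriesZ; exact: is_cvg_series_exp_coeff.
Qed.

Section bounded.
Variables (lam A : R) (a : nat -> C).
Hypotheses (l0 : 0 <= lam) (A0 : 0 <= A) (hA : forall n, modulus (a n) <= A * lam ^+ n).

Lemma egf_term_bound z n :
  modulus (a n / n`!%:R * z ^+ n) <= A * exp_coeff (lam * modulus z) n.
Proof.
rewrite !modulusM modulus_fact modulusX /exp_coeff /= exprMn.
rewrite [leRHS](_ : _ = A * lam ^+ n * (n`!%:R)^-1 * modulus z ^+ n); last by ring.
by rewrite ler_wpM2r ?exprn_ge0 ?modulus_ge0// ler_wpM2r.
Qed.

Lemma cvgn_egf z : cvgn (series (fun n => a n / n`!%:R * z ^+ n)).
Proof. exact: cvgC_series (egf_term_bound z) (@cvgn_exp_coeffZ _ _). Qed.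

Lemma qderiv_egf_bounded : qderiv (egf a) (egf (fun n => a n.+1)).
Proof.
move=> r; exists (A * lam ^+ 2 * expR (lam * (r + r))) => z k hz hk.
have cS : cvgn (series (fun n => a n.+1 / n`!%:R * z ^+ n)).
  suff hb n : modulus (a n.+1 / n`!%:R * z ^+ n) <= A * lam * exp_coeff (lam * modulus z) n.
    exact: cvgC_series hb (@cvgn_exp_coeffZ _ _).
  rewrite !modulusM modulus_fact modulusX /exp_coeff /= exprMn.
  rewrite [leRHS](_ : _ = A * lam ^+ n.+1 * (n`!%:R)^-1 * modulus z ^+ n); last by rewrite exprS; ring.
  by rewrite ler_wpM2r ?exprn_ge0 ?modulus_ge0// ler_wpM2r.
pose s w := series (fun n => a n / n`!%:R * w ^+ n).
(* The truncations at [N + 2] and [N + 1] match term by term, since differentiation lowers the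
   degree by one. The terms of degree 0 and 1 then cancel exactly. *)
have h : (fun N => s (z + k) N.+2 - s z N.+2 -
    k * series (fun n => a n.+1 / n`!%:R * z ^+ n) N.+1) @ \oo -->
    egf a (z + k) - egf a z - k * egf (fun n => a n.+1) z.
  have sh2 w : (fun N => s w N.+2) @ \oo --> egf a w.
    have := @cvgn_egf w; rewrite -(cvg_shiftn 2) => h.
    by apply: cvg_congr h => // n /=; rewrite addn2.
  have sh1 : (fun N => series (fun n => a n.+1 / n`!%:R * z ^+ n) N.+1) @ \oo -->
     egf (fun n => a n.+1) z.
    have := cS; rewrite -(cvg_shiftn 1) => h.
    by apply: cvg_congr h => // n /=; rewrite addn1.
  apply: cvgB; first by apply: cvgB; exact: sh2.
  by apply: cvgM; [exact: cvg_cst|exact: sh1].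
apply: (modulus_lim_le h) => N.
rewrite /s /series /= -sumrB [\sum_(0 <= i < N.+2) _]big_nat_recl// !expr0 subrr add0r mulr_sumr -sumrB.
rewrite big_nat_recl// expr0 (_ : _ - _ - _ = 0); last first.
  by rewrite (_ : 1`! = 1%N)// fact0; ring.
rewrite add0r.
apply: le_trans (modulus_sum _ _ _) _.
apply: (@le_trans _ _ (\sum_(0 <= n < N) A * lam ^+ 2 * modulus k ^+ 2 * exp_coeff (lam * (r + r)) n)).
  apply: ler_sum => n _.
  rewrite [X in modulus X](_ : _ = a n.+2 *
    ((z + k) ^+ n.+2 / n.+2`!%:R - z ^+ n.+2 / n.+2`!%:R - k * (z ^+ n.+1 / n.+1`!%:R))); last by ring.
  rewrite modulusM /exp_coeff /= exprMn.
  rewrite [leRHS](_ : _ = A * lam ^+ n.+2 * (modulus k ^+ 2 * ((r + r) ^+ n / n`!%:R))); last first.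
    by rewrite -[n.+2]addn2 exprD; ring.
  apply: ler_pM => //; rewrite ?modulus_ge0//.
  by apply: divpowD_bound; exact: lerD.
rewrite -mulr_sumr [leRHS](_ : _ = A * lam ^+ 2 * modulus k ^+ 2 * expR (lam * (r + r))); last by ring.
have r0 : 0 <= r := le_trans (modulus_ge0 z) hz.
rewrite ler_wpM2l ?mulr_ge0 ?exprn_ge0 ?modulus_ge0//.
apply: (@nondecreasing_cvgn_le _ (series (exp_coeff (lam * (r + r))))).
  by apply: nondecreasing_series => n _ _; rewrite exp_coeff_ge0 ?mulr_ge0 ?addr_ge0.
exact: is_cvg_series_exp_coeff.
Qed.

End bounded.

Lemma qderiv_egf lam a : 0 <= lam -> exp_bounded lam a ->
  qderiv (egf a) (egf (fun n => a n.+1)).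
Proof. by move=> l0 [A A0 hA]; exact: (qderiv_egf_bounded l0 A0 hA). Qed.

End Egf.

(** * Integral bounds along rays *)

Lemma continuous_horner_numField (K : numFieldType) (p : {poly K}) :
  continuous (horner p : K -> K).
Proof.
elim/poly_ind: p => [|p c IH].
  rewrite (_ : horner 0 = cst 0); first exact: cst_continuous.
  by apply/funext => x; rewrite horner0.
rewrite (_ : horner _ = (fun x => p.[x] * x + c)); last first.
  by apply/funext => x; rewrite hornerMXaddC.
move=> x; apply: (@continuousD _ _ _ (fun x : K => p.[x] * x) (cst c)).
  by apply: (@continuousM _ _ (fun x : K => p.[x]) id); [exact: IH|exact: cvg_id].
exact: cst_continuous.
Qed.

Section KernelBound.
Variable R : realType.
Local Notation C := (Cplx R).
Local Notation mu := (@lebesgue_measure R).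
Local Notation Rp := (`]0, +oo[%classic : set R).

Lemma modulus_dist (z w : C) : `|modulus z - modulus w| <= modulus (z - w).
Proof.
rewrite ler_norml; apply/andP; split.
  rewrite lerNl opprB lerBlDr -[in leLHS](subrK z w) modulusBC.
  exact: modulusD.
by rewrite lerBlDr -[in leLHS](subrK w z) modulusD.
Qed.

Lemma continuous_modulus_line (F : C -> C) (t v : C) :
  (forall x : R, {for t + x%:C * v, continuous F}) ->
  continuous (fun x : R => modulus (F (t + x%:C * v))).
Proof.
move=> cF x; apply/cvgrPdist_le => e e0.
have /cvgrPdist_lt : F z @[z --> t + x%:C * v] --> F (t + x%:C * v) by exact: cF.
move=> /(_ (e%:C : C)); rewrite ltcR => /(_ e0).
move=> [d /= d0 hd].
have [dI dR] : complex.Im d = 0 /\ 0 < complex.Re d.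
  by move: d0; rewrite ltcE => /andP[/eqP -> ->].
have V0 : 0 < modulus v + 1 by rewrite ltr_wpDl ?modulus_ge0.
have d1 : 0 < complex.Re d / (modulus v + 1) by rewrite divr_gt0.
near=> y.
apply: le_trans (modulus_dist _ _) _; apply: ltW.
have : `|F (t + x%:C * v) - F (t + y%:C * v)| < (e%:C : C).
  apply: hd; rewrite /ball /= modulusE ltcE /= dI eqxx /=.
  rewrite opprD addrACA subrr add0r -mulrBl -rmorphB modulusM modulus_real.
  apply: (@le_lt_trans _ _ (`|x - y| * (modulus v + 1))).
    by rewrite ler_wpM2l// lerDl.
  rewrite -ltr_pdivlMr//; near: y; exact: (cvgr_dist_lt (@cvg_id _ _)).
by rewrite modulusE ltcR.
Unshelve. all: by end_near. Qed.

Lemma measurable_modulus_line (F : C -> C) (t v : C) (D : set R) :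
  (forall x : R, {for t + x%:C * v, continuous F}) ->
  measurable_fun D (fun x : R => modulus (F (t + x%:C * v))).
Proof.
move=> cF; apply: measurable_funTS; apply: continuous_measurable_fun.
exact: continuous_modulus_line.
Qed.

(** A finite combination of moments is an actual integral against the kernel, and [fermi_le] trades
    the kernel for the weight of the class [T]. The majorant is only required to be measurable with
    a bounded integral, which is what the class provides. *)
Lemma fermi_moment_poly_le (r : nat -> R) (M : R -> R) n (B : R) :
  measurable_fun Rp M ->
  (forall x, 0 < x -> `|\sum_(j < n) r j * x ^+ j| <= M x) ->
  (\int[mu]_(x in Rp) (M x * expR (- (2 * pi) * x))%:E <= B%:E)%E ->
  `|\sum_(j < n) r j * fermi_moment R j| <= B.
Proof.
move=> mM rM hB.
pose u (m : nat) (x : R) := (\sum_(j < m) r j * x ^+ j) * fermi x.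
have [iu eu] : mu.-integrable Rp (fun x => (u n x)%:E) /\
    \int[mu]_(x in Rp) u n x = \sum_(j < n) r j * fermi_moment R j.
  rewrite /u {rM}; elim: n => [|n [IH1 IH2]].
    have e x : (\sum_(j < 0) r j * x ^+ j) * fermi x = 0 by rewrite big_ord0 mul0r.
    split.
      by rewrite (_ : (fun x : R => _) = cst 0%E); [exact: integrable0|apply/funext => x; rewrite e].
    rewrite big_ord0 -[RHS](_ : \int[mu]_(x in Rp) 0 = 0).
      by apply: eq_Rintegral => x _; exact: e.
    by rewrite /Rintegral integral0.
  have e x : (\sum_(j < n.+1) r j * x ^+ j) * fermi x =
     (\sum_(j < n) r j * x ^+ j) * fermi x + r n * (x ^+ n * fermi x).
    by rewrite big_ord_recr /= mulrDl mulrA.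
  have i1 : mu.-integrable Rp (fun x : R => (x ^+ n * fermi x)%:E).
    have := @integrable_pow_fermi R 0 n (lexx _).
    apply: eq_integrable => // x _.
    by rewrite oppr0 mul0r expR0 mulr1.
  have i2 : mu.-integrable Rp (fun x : R => (r n * (x ^+ n * fermi x))%:E).
    rewrite (_ : (fun x : R => _) = (fun x : R => (r n)%:E * (x ^+ n * fermi x)%:E)%E)//.
    exact: integrableZl.
  split.
    rewrite (_ : (fun x : R => _) = (fun x : R =>
      ((\sum_(j < n) r j * x ^+ j) * fermi x)%:E + (r n * (x ^+ n * fermi x))%:E)%E).
      exact: integrableD.
    by apply/funext => x; rewrite e.
  transitivity (\int[mu]_(x in Rp)
    ((\sum_(j < n) r j * x ^+ j) * fermi x + r n * (x ^+ n * fermi x))).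
    by apply: eq_Rintegral => x _; exact: e.
  by rewrite RintegralD// IH2 RintegralZl// big_ord_recr.
rewrite -eu -lee_fin; apply: le_trans _ hB.
have /integrableP[mu_ _] := iu.
rewrite EFin_normr_Rintegral//; apply: le_trans (le_abse_integral _ _ mu_) _ => //.
apply: ge0_le_integral => //.
- by apply: measurableT_comp.
- apply/measurable_EFinP; apply: measurable_funM => //.
  rewrite (_ : (fun x : R => _) = (fun x : R => x ^+ 0 * expR (- (2 * pi) * x))).
    exact: measurable_powexp.
  by apply/funext => x; rewrite expr0 mul1r.
move=> x /=; rewrite in_itv /= andbT => x0.
rewrite lee_fin /u normrM; apply: ler_pM => //; first exact: rM.
by rewrite ger0_norm ?fermi_ge0// fermi_le.
Qed.

(** Real and imaginary parts are treated as real polynomials, each dominated by the modulus; this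
    costs the factor 2. *)
Lemma fermi_moment_cpoly_le (w : nat -> C) n (B : R) :
  (\int[mu]_(x in Rp) (modulus (\sum_(j < n) w j * (x%:C : C) ^+ j) * expR (- (2 * pi) * x))%:E <= B%:E)%E ->
  modulus (\sum_(j < n) w j * (fermi_moment R j)%:C) <= 2 * B.
Proof.
move=> hB.
have mM : measurable_fun Rp (fun x : R => modulus (\sum_(j < n) w j * (x%:C : C) ^+ j)).
  rewrite (_ : (fun x : R => _) = (fun x : R =>
     modulus ((\poly_(j < n) w j).[0 + (x%:C : C) * 1]))).
    apply: measurable_modulus_line => x.
    exact: continuous_horner_numField.
  by apply/funext => x; rewrite add0r mulr1 horner_poly.
have RI (z : C) (x : R) : complex.Re (z * (x%:C : C)) = complex.Re z * x /\
    complex.Im (z * (x%:C : C)) = complex.Im z * x.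
  by rewrite mulrC Re_real_mul Im_real_mul mulrC [x * complex.Im z]mulrC.
apply: le_trans (modulus_le_ReIm _) _; rewrite mulr2n mulrDl mul1r.
rewrite Re_sum Im_sum; apply: lerD.
  under eq_bigr do rewrite (RI _ _).1.
  apply: (@fermi_moment_poly_le (fun j => complex.Re (w j)) _ n B mM _ hB) => x x0.
  apply: le_trans (ler_Re_modulus _); rewrite Re_sum le_eqVlt; apply/orP; left; apply/eqP.
  by congr `| _ |; apply: eq_bigr => j _; rewrite -rmorphXn (RI _ _).1.
under eq_bigr do rewrite (RI _ _).2.
apply: (@fermi_moment_poly_le (fun j => complex.Im (w j)) _ n B mM _ hB) => x x0.
apply: le_trans (ler_Im_modulus _); rewrite Im_sum le_eqVlt; apply/orP; left; apply/eqP.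
by congr `| _ |; apply: eq_bigr => j _; rewrite -rmorphXn (RI _ _).2.
Qed.

End KernelBound.

Section ShiftedLaplace.
Variable R : realType.
Local Notation mu := (@lebesgue_measure R).
Local Notation Rp := (`]0, +oo[%classic : set R).

Lemma lap_prim_ge (m c : R) j : 0 < m -> 0 <= c ->
  - (j`!%:R / m ^+ j.+1) <= lap_prim m j c.
Proof.
move=> m0 c0; have mn0 := lt0r_neq0 m0; rewrite -lap_prim0//.
have dF x := @is_derive_lap_prim R m x j mn0.
have [|y y_in] := @MVT_segment R _ _ _ _ c0 (fun x _ => dF x).
  apply: continuous_subspaceT => x; apply: differentiable_continuous.
  by apply/derivable1_diffP; have [] := dF x.
move: y_in; rewrite in_itv /= subr0 => /andP[y0 _] h.
by rewrite -subr_ge0 h !mulr_ge0 ?exprn_ge0 ?expR_ge0.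
Qed.

Lemma is_derive_shift (F : R -> R) (c x d : R) : is_derive (c + x) 1 F d ->
  is_derive x 1 (fun y => F (c + y)) d.
Proof.
move=> dF.
have h : is_derive x 1 (fun y => c + y) 1.
  by apply: (is_derive_eq (is_deriveD (is_derive_cst c x 1) (is_derive_id x 1))); rewrite add0r.
apply: (is_derive_eq (@is_derive1_comp _ F (fun y => c + y) x _ _ dF h)).
exact: mulr1.
Qed.

Lemma continuous_shift_powexp (m c : R) j :
  continuous (fun x : R => (c + x) ^+ j * expR (- m * x)).
Proof.
move=> x; apply: cvgM.
  apply: (@continuous_comp _ _ _ (fun y => c + y) (fun y => y ^+ j)); last exact: exprn_continuous.
  by apply: cvgD; [exact: cvg_cst|exact: cvg_id].
apply: (@continuous_comp _ _ _ (fun y => - m * y) expR); last exact: continuous_expR.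
exact: mulrl_continuous.
Qed.

(** Translation by [c] gives [exp (m c)] times the part of the Gamma integral beyond [c], hence at
    most the whole of it. In the application [c = |t|], because [|t + x th| <= |t| + x] on a ray
    with [|th| = 1]. *)
Lemma integral_shift_powexp_le (m c : R) j : 0 < m -> 0 <= c ->
  (\int[mu]_(x in Rp) ((c + x) ^+ j * expR (- m * x))%:E <=
   (expR (m * c) * (j`!%:R / m ^+ j.+1))%:E)%E.
Proof.
move=> m0 c0; have mn0 := lt0r_neq0 m0.
rewrite integral_itv_obnd_cbnd; last first.
  apply/measurable_EFinP; apply: measurable_funTS; apply: continuous_measurable_fun.
  exact: continuous_shift_powexp.
pose F x := expR (m * c) * lap_prim m j (c + x).
have dF (x : R) : is_derive x 1 F ((c + x) ^+ j * expR (- m * x)).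
  apply: (is_derive_eq (is_deriveZ (expR (m * c)) (is_derive_shift (@is_derive_lap_prim R m (c + x) j mn0)))).
  rewrite /GRing.scale /= mulrCA -expRD; congr (_ * expR _); ring.
rewrite (@ge0_continuous_FTC2y _ _ F _ 0).
- rewrite -EFinD lee_fin sub0r /F addr0 -mulrN ler_wpM2l ?expR_ge0//.
  by rewrite lerNl lap_prim_ge.
- by move=> x x0; rewrite mulr_ge0 ?exprn_ge0 ?expR_ge0 ?addr_ge0.
- exact/continuous_subspaceT/continuous_shift_powexp.
- rewrite -(mulr0 (expR (m * c))); apply: cvgM; first exact: cvg_cst.
  apply: (@cvg_comp _ _ _ (fun x => c + x) (lap_prim m j) _ +oo); last exact: cvg_lap_prim.
  exact: cvg_addrl.
- by move=> x _; have [] := dF x.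
- apply: cvg_at_right_filter; apply: differentiable_continuous.
  by apply/derivable1_diffP; have [] := dF 0.
- by move=> x _; rewrite derive1E; have [_ ->] := dF x.
Qed.

End ShiftedLaplace.

(** * Series of Appell polynomials *)

Section Functional.
Variable R : realType.
Local Notation C := (Cplx R).
Local Notation mu := (@lebesgue_measure R).
Local Notation Rp := (`]0, +oo[%classic : set R).

(* [euler_fun p = i int_0^oo (p (i x) - p (- i x)) / (exp (2 pi x) + 1) dx]. *)
Definition euler_fun (p : {poly C}) : C :=
  \sum_(j < size p) p`_j * (j`!%:R * (euler_coef R j)%:C).

Lemma euler_funE (p : {poly C}) N : (size p <= N)%N ->
  euler_fun p = \sum_(j < N) p`_j * (j`!%:R * (euler_coef R j)%:C).
Proof.
move=> pN; rewrite /euler_fun (big_ord_widen N (fun j => p`_j * (j`!%:R * (euler_coef R j)%:C)) pN).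
rewrite [RHS](bigID (fun j : 'I_N => (j < size p)%N)) /= [X in _ = _ + X]big1 ?addr0//.
by move=> j; rewrite -leqNgt => h; rewrite nth_default ?mul0r.
Qed.

Lemma euler_funD p q : euler_fun (p + q) = euler_fun p + euler_fun q.
Proof.
pose N := maxn (size p) (size q).
rewrite (euler_funE (N := N)) ?size_polyD// (euler_funE (p := p) (N := N)) ?leq_maxl//.
rewrite (euler_funE (p := q) (N := N)) ?leq_maxr// -big_split /=.
by apply: eq_bigr => j _; rewrite coefD mulrDl.
Qed.

Lemma euler_funZ (c : C) p : euler_fun (c *: p) = c * euler_fun p.
Proof.
rewrite (euler_funE (N := size p)) ?size_scale_leq// mulr_sumr.
by apply: eq_bigr => j _; rewrite coefZ -mulrA.
Qed.

Lemma euler_fun0 : euler_fun 0 = 0.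
Proof. by rewrite /euler_fun size_poly0 big_ord0. Qed.

Lemma euler_fun_sum n (F : nat -> {poly C}) :
  euler_fun (\sum_(i < n) F i) = \sum_(i < n) euler_fun (F i).
Proof.
elim: n => [|n IH]; first by rewrite !big_ord0 euler_fun0.
by rewrite !big_ord_recr /= euler_funD IH.
Qed.

Lemma euler_funXn j : euler_fun 'X^j = j`!%:R * (euler_coef R j)%:C.
Proof.
rewrite (euler_funE (N := j.+1)) ?size_polyXn// big_ord_recr /= coefXn eqxx mul1r.
by rewrite big1 ?add0r// => i _; rewrite coefXn ltn_eqF ?mul0r.
Qed.

(** The binomial expansion of a translated power: evaluating an Appell polynomial at [t] is applying
    the kernel functional to the monomial re-centred at [t], which gives access to integrals along
    vertical rays. *)
Lemma euler_fun_appell (t : C) n :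
  euler_fun ((n`!%:R)^-1 *: (t%:P + 'X) ^+ n) = (appell R n).[t].
Proof.
rewrite exprDn scaler_sumr horner_appell.
rewrite (eq_bigr (fun i : 'I_n.+1 => ((n`!%:R)^-1 * t ^+ (n - i) * 'C(n, i)%:R) *: 'X^i)); last first.
  move=> i _; rewrite -polyC_exp mul_polyC -[_ *+ 'C(n, i)]scaler_nat !scalerA.
  by congr (_ *: _); ring.
rewrite (euler_fun_sum n.+1 (fun i => ((n`!%:R)^-1 * t ^+ (n - i) * 'C(n, i)%:R) *: 'X^i)).
apply: eq_bigr => i _; rewrite euler_funZ euler_funXn.
have le_in : (i <= n)%N by rewrite -ltnS.
have f0 m : (m`!%:R : C) != 0 by rewrite pnatr_eq0 -lt0n fact_gt0.
rewrite [RHS]mulrC mulrA; congr (_ * _).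
have := bin_fact le_in => /(congr1 (fun m => m%:R : C)); rewrite !natrM => <-.
have b0 : ('C(n, i)%:R : C) != 0 by rewrite pnatr_eq0 -lt0n bin_gt0.
move: (f0 i) (f0 (n - i)%N) b0.
move: (i`!%:R : C) ((n - i)`!%:R : C) ('C(n, i)%:R : C) => x y z x0 y0 z0.
by field; rewrite x0 y0 z0.
Qed.

Lemma euler_fun_bound (p : {poly C}) (B1 B2 : R) :
  (\int[mu]_(x in Rp) (modulus (p.[(x%:C : C) * (0 +i* 1)]) * expR (- (2 * pi) * x))%:E <= B1%:E)%E ->
  (\int[mu]_(x in Rp) (modulus (p.[(x%:C : C) * - (0 +i* 1)]) * expR (- (2 * pi) * x))%:E <= B2%:E)%E ->
  modulus (euler_fun p) <= 2 * B1 + 2 * B2.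
Proof.
set i : C := 0 +i* 1.
have i1 : modulus i = 1 by rewrite /modulus /= expr0n add0r expr1n sqrtr1.
have aux (th : C) (B : R) :
  (\int[mu]_(x in Rp) (modulus (p.[(x%:C : C) * th]) * expR (- (2 * pi) * x))%:E <= B%:E)%E ->
  modulus (\sum_(j < size p) (p`_j * th ^+ j) * (fermi_moment R j)%:C) <= 2 * B.
  move=> h; apply: (@fermi_moment_cpoly_le R (fun j => p`_j * th ^+ j)).
  rewrite (_ : (\int[mu]_(x in Rp) _ = \int[mu]_(x in Rp) (modulus (p.[(x%:C : C) * th]) * expR (- (2 * pi) * x))%:E)%E)//.
  apply: eq_integral => x _; congr (modulus _ * _)%:E.
  by rewrite horner_coef; apply: eq_bigr => j _; rewrite exprMn -mulrA [th ^+ j * _]mulrC.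
move=> /aux h1 /aux h2.
rewrite [euler_fun p](_ : _ = i * (\sum_(j < size p) (p`_j * i ^+ j) * (fermi_moment R j)%:C
   - \sum_(j < size p) (p`_j * (- i) ^+ j) * (fermi_moment R j)%:C)).
  rewrite modulusM i1 mul1r; apply: le_trans (modulusB _ _) _; exact: lerD.
rewrite -sumrB mulr_sumr; apply: eq_bigr => j _.
have f0 : (j`!%:R : C) != 0 by rewrite pnatr_eq0 -lt0n fact_gt0.
rewrite /euler_coef !rmorphM fmorphV rmorph_nat /= sgn_coefE -/i [(- i) ^+ j]exprNn exprS.
by field.
Qed.

End Functional.

Section AppellSeries.
Variable R : realType.
Local Notation C := (Cplx R).
Local Notation mu := (@lebesgue_measure R).
Local Notation Rp := (`]0, +oo[%classic : set R).

Lemma nneseries_EFin_lim (w : nat -> R) : cvgn (series w) ->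
  (\sum_(0 <= n <oo) (w n)%:E)%E = (limn (series w))%:E.
Proof.
move=> cw; rewrite -EFin_lim//; congr (limn _).
by apply/funext => n; rewrite /series /= sumEFin.
Qed.

Lemma cvg_series_shift (v : nat -> R) N : cvgn (series v) ->
  series (fun n => v (n + N)%N) @ \oo --> limn (series v) - series v N.
Proof.
move=> cv.
have h : (fun n => series v (n + N)%N - series v N) @ \oo --> limn (series v) - series v N.
  by apply: cvgB; [rewrite cvg_shiftn|exact: cvg_cst].
apply: cvg_congr h => // n.
rewrite sub_series_geq ?leq_addl// /series /=.
by rewrite -{1}[N]add0n big_addn addnK.
Qed.

Variable a : nat -> C.
Hypothesis sa : cvgn (series (fun n => (2 * pi) ^- n * modulus (a n))).
Let lam : R := 2 * pi.
Let lam0 : 0 < lam := mul2pi_gt0 R.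

Lemma summable_exp_bounded : exp_bounded lam a.
Proof.
have [B [B0 hB]] : exists B : R, 0 <= B /\ forall n, lam ^- n * modulus (a n) <= B.
  exists (limn (series (fun n => (2 * pi) ^- n * modulus (a n)))); split.
    apply: limr_ge => //; apply: nearW => n; apply: sumr_ge0 => i _.
    by rewrite mulr_ge0 ?invr_ge0 ?exprn_ge0 ?modulus_ge0// ltW.
  have pos i : 0 <= (2 * pi) ^- i * modulus (a i).
    by rewrite mulr_ge0 ?invr_ge0 ?exprn_ge0 ?modulus_ge0// ltW.
  move=> n; apply: le_trans (nondecreasing_cvgn_le _ sa n.+1).
    by rewrite seriesEnat /= big_nat_recr//= lerDr sumr_ge0.
  exact: nondecreasing_series.
exists B => // n.
by rewrite -ler_pdivrMr ?exprn_gt0// mulrC.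
Qed.

(** The coefficient bound [2 / (2 pi)^(j+1)] leaves [(2 pi)^-(n+1)] times a partial sum of
    [exp (2 pi |t|)]. This rate is the reason for the weight [(2 pi)^-n] in the hypothesis on
    [a]. *)
Lemma modulus_appell_le t n :
  modulus (appell R n).[t] <= 2 * expR (lam * modulus t) / lam ^+ n.+1.
Proof.
rewrite horner_appell; apply: le_trans (modulus_sum _ _ _) _.
apply: (@le_trans _ _ (\sum_(j < n.+1) 2 / lam ^+ n.+1 * exp_coeff (lam * modulus t) (n - j)%N)).
  apply: ler_sum => j _; have jn : (j <= n)%N by rewrite -ltnS.
  rewrite modulusM modulus_real modulusM modulus_fact modulusX /exp_coeff /= [(lam * modulus t) ^+ _]exprMn.
  have -> : lam ^+ n.+1 = lam ^+ j.+1 * lam ^+ (n - j) by rewrite -exprD addSn subnKC.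
  have l1 : lam ^+ (n - j) != 0 by rewrite expf_neq0 ?gt_eqF.
  rewrite [leRHS](_ : _ = 2 / lam ^+ j.+1 * (modulus t ^+ (n - j) / (n - j)`!%:R)).
    by rewrite ler_wpM2r ?euler_coef_bound// mulr_ge0 ?exprn_ge0 ?modulus_ge0.
  have l2 : lam ^+ j.+1 != 0 by rewrite expf_neq0 ?gt_eqF.
  have l3 : ((n - j)`!%:R : R) != 0 by rewrite gt_eqF// ltr0n fact_gt0.
  move: (lam ^+ (n - j)) l1 (lam ^+ j.+1) l2 ((n - j)`!%:R : R) l3 => y y0 x' x0 f' f0.
  by field; rewrite y0 x0 f0.
rewrite -mulr_sumr [leRHS](_ : _ = 2 / lam ^+ n.+1 * expR (lam * modulus t)); last by ring.
rewrite ler_wpM2l ?divr_ge0 ?exprn_ge0 ?(ltW lam0)//.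
have -> : \sum_(j < n.+1) exp_coeff (lam * modulus t) (n - j)%N = series (exp_coeff (lam * modulus t)) n.+1.
  rewrite /series /= big_mkord (reindex_inj rev_ord_inj) /=; apply: eq_bigr => j _.
  by rewrite subSS subKn// -ltnS.
apply: (@nondecreasing_cvgn_le _ (series (exp_coeff (lam * modulus t)))).
  apply: nondecreasing_series => m _ _; apply: exp_coeff_ge0.
  by apply: mulr_ge0; [exact: ltW|exact: modulus_ge0].
exact: is_cvg_series_exp_coeff.
Qed.

Lemma cvgn_appell_series t : cvgn (series (fun n => a n * (appell R n).[t])).
Proof.
have h n : modulus (a n * (appell R n).[t]) <=
   2 * expR (lam * modulus t) / lam * ((2 * pi) ^- n * modulus (a n)).
  rewrite modulusM mulrC.
  rewrite [leRHS](_ : _ = 2 * expR (lam * modulus t) / lam ^+ n.+1 * modulus (a n)).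
    by rewrite ler_wpM2r ?modulus_ge0 ?modulus_appell_le.
  rewrite -/lam exprSr [(lam ^+ n * lam)^-1]invfM; move: (lam ^- n) (lam^-1) => u v; ring.
apply: (cvgC_series h).
rewrite (_ : (fun n => _) = (2 * expR (lam * modulus t) / lam) *:
   (fun n => (2 * pi) ^- n * modulus (a n))); last by apply/funext.
exact: is_cvg_seriesZ.
Qed.

Let e (x : R) : R := expR (- (2 * pi) * x).
Let part N (z : C) : C := \sum_(n < N) a n / n`!%:R * z ^+ n.
(** A bound for the integral of [tail]: [n! / (2 pi)^(n+1)] from the shifted Gamma integral cancels
    [1 / n!] and leaves the remainder of the hypothesis series. *)
Let tau (c : R) N : R := expR (lam * c) / lam *
  (limn (series (fun n => (2 * pi) ^- n * modulus (a n))) -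
   series (fun n => (2 * pi) ^- n * modulus (a n)) N).

(** A majorant on a ray from a point of modulus [c] for the error of truncating [egf a] after [N]
    terms. It is extended-real valued so that a series of nonnegative terms can be integrated term
    by term. *)
Let tail (c : R) N (x : R) : \bar R := (\sum_(0 <= n <oo)
  (modulus (a (n + N)%N) / (n + N)`!%:R * ((c + x) ^+ (n + N) * e x))%:E)%E.

Let tail_term_ge0 c N x n : 0 <= c -> 0 < x ->
  0 <= modulus (a (n + N)%N) / (n + N)`!%:R * ((c + x) ^+ (n + N) * e x).
Proof.
move=> c0 x0; apply: mulr_ge0; first by rewrite divr_ge0 ?modulus_ge0 ?ler0n.
by rewrite mulr_ge0 ?expR_ge0// exprn_ge0// addr_ge0// ltW.
Qed.

Let tail_pointwise (t th : C) N x : modulus th = 1 -> 0 < x ->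
  ((modulus (egf a (t + x%:C * th) - part N (t + x%:C * th)) * e x)%:E <=
    tail (modulus t) N x)%E.
Proof.
move=> th1 x0; set z := t + x%:C * th; set c := modulus t.
have zc : modulus z <= c + x.
  rewrite (le_trans (modulusD _ _))// modulusM th1 mulr1 modulus_real gtr0_norm//.
pose v n := modulus (a n) / n`!%:R * (c + x) ^+ n.
have cx0 : 0 <= c + x by rewrite addr_ge0 ?modulus_ge0// ltW.
have [A A0 hA] := summable_exp_bounded.
have cv : cvgn (series v).
  apply: (@series_le_cvg _ v (fun n => A * exp_coeff (lam * (c + x)) n)).
  - by move=> n; rewrite /v mulr_ge0 ?divr_ge0 ?modulus_ge0 ?ler0n ?exprn_ge0.
  - by move=> n; rewrite mulr_ge0// exp_coeff_ge0// mulr_ge0// ltW.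
  - move=> n; rewrite /v /exp_coeff /= [(lam * _) ^+ _]exprMn.
    rewrite [leRHS](_ : _ = A * lam ^+ n / n`!%:R * (c + x) ^+ n); last by ring.
    by rewrite ler_wpM2r ?exprn_ge0// ler_wpM2r.
  - exact: cvgn_exp_coeffZ.
have uv n : modulus (a n / n`!%:R * z ^+ n) <= v n.
  rewrite !modulusM modulus_fact modulusX /v ler_wpM2l ?divr_ge0 ?modulus_ge0 ?ler0n//.
  by apply: lerXn2r; rewrite ?nnegrE ?modulus_ge0.
have h := modulus_series_tail N uv cv.
pose w n := modulus (a (n + N)%N) / (n + N)`!%:R * ((c + x) ^+ (n + N) * e x).
have cw : series w @ \oo --> (limn (series v) - series v N) * e x.
  rewrite (_ : series w = fun n => series (fun n => v (n + N)%N) n * e x).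
    by apply: cvgM; [exact: cvg_series_shift|exact: cvg_cst].
  apply/funext => n.
  by rewrite /series /= mulr_suml; apply: eq_bigr => i _; rewrite /w mulrA.
rewrite /tail nneseries_EFin_lim; last by apply/cvg_ex; eexists; exact: cw.
rewrite (cvg_lim _ cw)// lee_fin ler_wpM2r ?expR_ge0//.
by move: h; rewrite /egf /part /series /= big_mkord.
Qed.

Let measurable_tail_term c N n : measurable_fun Rp
  (fun x : R => (modulus (a (n + N)%N) / (n + N)`!%:R * ((c + x) ^+ (n + N) * e x))%:E).
Proof.
apply/measurable_EFinP; apply: measurable_funM; first exact: measurable_cst.
apply: measurable_funTS; apply: continuous_measurable_fun.
exact: continuous_shift_powexp.
Qed.

Let integral_tail c N : 0 <= c ->
  (\int[mu]_(x in Rp) tail c N x <= (tau c N)%:E)%E.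
Proof.
move=> c0; have t0 n x : Rp x ->
    (0 <= (modulus (a (n + N)%N) / (n + N)`!%:R * ((c + x) ^+ (n + N) * e x))%:E)%E.
  by rewrite /= in_itv /= andbT => x0; rewrite lee_fin tail_term_ge0.
rewrite /tail integral_nneseries//; first last.
- by move=> n; exact: measurable_tail_term.
pose s n := (2 * pi) ^- n * modulus (a n).
have h : series (fun n => expR (lam * c) / lam * s (n + N)%N) @ \oo --> tau c N.
  rewrite (_ : series _ = fun n => expR (lam * c) / lam * series (fun n => s (n + N)%N) n).
    by apply: cvgM; [exact: cvg_cst|exact: cvg_series_shift].
  by apply/funext => n; rewrite /series /= mulr_sumr.
apply: (@le_trans _ _ (\sum_(0 <= n <oo) (expR (lam * c) / lam * s (n + N)%N)%:E)%E); last first.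
  rewrite nneseries_EFin_lim; last by apply/cvg_ex; eexists; exact: h.
  by rewrite (cvg_lim _ h).
apply: lee_nneseries => n _.
  by move=> _; apply: integral_ge0 => x /=; rewrite in_itv /= andbT => x0; rewrite lee_fin tail_term_ge0.
have k0 : 0 <= modulus (a (n + N)%N) / (n + N)`!%:R by rewrite divr_ge0 ?modulus_ge0 ?ler0n.
have := integral_shift_powexp_le (n + N) lam0 c0.
move=> /(lee_wpmul2l (_ : 0 <= (modulus (a (n + N)%N) / (n + N)`!%:R)%:E)%E).
rewrite lee_fin => /(_ k0); rewrite -ge0_integralZl_EFin//; last 2 first.
- by move=> x /=; rewrite in_itv /= andbT => x0; rewrite lee_fin mulr_ge0 ?expR_ge0// exprn_ge0// addr_ge0// ltW.
- apply/measurable_EFinP; apply: measurable_funTS; apply: continuous_measurable_fun.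
  exact: continuous_shift_powexp.
move=> /le_trans -> //; rewrite -EFinM lee_fin le_eqVlt; apply/orP; left; apply/eqP.
rewrite /s exprS -/lam.
have f0 : ((n + N)`!%:R : R) != 0 by rewrite gt_eqF// ltr0n fact_gt0.
have l0 : lam ^+ (n + N) != 0 by rewrite expf_neq0// gt_eqF.
have l1 : lam != 0 by rewrite gt_eqF.
by field; rewrite l0 l1 f0.
Qed.

(** On each ray the polynomial [P N] has weighted integral at most [B1] or [B2], plus [H / (2 pi)],
    plus [tau (modulus t) N]; [euler_fun_bound] doubles this, and the last part vanishes as [N]
    grows. The application takes [F = f], with [H] bounding the negative powers. *)
Lemma appell_series_bound (t : C) (F : C -> C) (k : nat) (d : nat -> C) (H B1 B2 : R) :
  (forall x : R, {for t + (x%:C : C) * (0 +i* 1), continuous F}) ->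
  (forall x : R, modulus (F (t + (x%:C : C) * (0 +i* 1)) - egf a (t + (x%:C : C) * (0 +i* 1))) <= H) ->
  (\int[mu]_(x in Rp) (modulus (F (t + (x%:C : C) * (0 +i* 1)) -
     \sum_(j < k) d j / j`!%:R * ((x%:C : C) * (0 +i* 1)) ^+ j) * expR (- (2 * pi) * x))%:E <= B1%:E)%E ->
  (\int[mu]_(x in Rp) (modulus (F (t + (x%:C : C) * - (0 +i* 1)) -
     \sum_(j < k) d j / j`!%:R * ((x%:C : C) * - (0 +i* 1)) ^+ j) * expR (- (2 * pi) * x))%:E <= B2%:E)%E ->
  modulus (limn (series (fun n => a n * (appell R n).[t])) -
    \sum_(j < k) d j * (euler_coef R j)%:C) <= 2 * (B1 + B2) + 4 * (H / (2 * pi)).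
Proof.
set i : C := 0 +i* 1 => cF hH hB1 hB2.
have H0 : 0 <= H by rewrite (le_trans _ (hH 0))// modulus_ge0.
have i1 : modulus i = 1 by rewrite /modulus /= expr0n add0r expr1n sqrtr1.
pose P N : {poly C} := \sum_(n < N) a n *: ((n`!%:R)^-1 *: (t%:P + 'X) ^+ n) -
   \sum_(j < k) (d j / j`!%:R) *: 'X^j.
have PE N z : (P N).[z] = part N (t + z) - \sum_(j < k) d j / j`!%:R * z ^+ j.
  rewrite /P hornerD hornerN !horner_sum; congr (_ - _).
    by apply: eq_bigr => n _; rewrite !hornerZ horner_exp hornerD hornerC hornerX mulrA.
  by apply: eq_bigr => j _; rewrite hornerZ hornerXn.
have LP N : euler_fun (P N) = series (fun n => a n * (appell R n).[t]) N -
    \sum_(j < k) d j * (euler_coef R j)%:C.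
  rewrite /P -scaleN1r euler_funD euler_funZ mulN1r; congr (_ - _).
    rewrite (euler_fun_sum N (fun n => a n *: ((n`!%:R)^-1 *: (t%:P + 'X) ^+ n))).
    rewrite /series /= big_mkord; apply: eq_bigr => n _.
    by rewrite euler_funZ euler_fun_appell.
  rewrite (euler_fun_sum k (fun j => (d j / j`!%:R) *: 'X^j)); apply: eq_bigr => j _.
  by rewrite euler_funZ euler_funXn mulrA divfK// pnatr_eq0 -lt0n fact_gt0.
have aux N (th : C) B : modulus th = 1 ->
    (forall x : R, {for t + (x%:C : C) * th, continuous F}) ->
    (forall x : R, modulus (F (t + (x%:C : C) * th) - egf a (t + (x%:C : C) * th)) <= H) ->
    (\int[mu]_(x in Rp) (modulus (F (t + (x%:C : C) * th) -
     \sum_(j < k) d j / j`!%:R * ((x%:C : C) * th) ^+ j) * expR (- (2 * pi) * x))%:E <= B%:E)%E ->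
    (\int[mu]_(x in Rp) (modulus ((P N).[(x%:C : C) * th]) * expR (- (2 * pi) * x))%:E <=
       (B + H / (2 * pi) + tau (modulus t) N)%:E)%E.
  move=> th1 cFt hHt hB.
  have me : measurable_fun Rp e.
    rewrite (_ : e = (fun x : R => x ^+ 0 * expR (- (2 * pi) * x))).
      exact: measurable_powexp.
    by apply/funext => x; rewrite expr0 mul1r.
  pose phi (x : R) := modulus (F (t + (x%:C : C) * th) -
     \sum_(j < k) d j / j`!%:R * ((x%:C : C) * th) ^+ j).
  have mphi : measurable_fun Rp phi.
    pose q : {poly C} := (\sum_(j < k) (d j / j`!%:R) *: 'X^j) \Po ('X - t%:P).
    rewrite (_ : phi = fun x : R => modulus ((fun z => F z - q.[z]) (t + (x%:C : C) * th))).
      apply: (@measurable_modulus_line R (fun z => F z - q.[z])) => x.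
      by apply: (@continuousB _ _ _ F (horner q)); [exact: cFt|exact: continuous_horner_numField].
    apply/funext => x; rewrite /phi /q horner_comp hornerD hornerN hornerX hornerC [t + _]addrC addrK.
    rewrite horner_sum [_ + t]addrC; congr (modulus (_ - _)); apply: eq_bigr => j _.
    by rewrite hornerZ hornerXn.
  have mtail : measurable_fun Rp (tail (modulus t) N).
    apply: ge0_emeasurable_sum => n.
      by move=> x /=; rewrite in_itv /= andbT => x0 _; rewrite lee_fin tail_term_ge0 ?modulus_ge0.
    by move=> _; exact: measurable_tail_term.
  have tail0 x : Rp x -> (0 <= tail (modulus t) N x)%E.
    rewrite /= in_itv /= andbT => x0; apply: nneseries_ge0 => n _ _.
    by rewrite lee_fin tail_term_ge0 ?modulus_ge0.
  have mHe : measurable_fun Rp (fun x => (H * e x)%:E).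
    by apply/measurable_EFinP; apply: measurable_funM.
  have mpe : measurable_fun Rp (fun x => (phi x * e x)%:E).
    by apply/measurable_EFinP; apply: measurable_funM.
  have e0 x : 0 <= e x by exact: expR_ge0.
  apply: (@le_trans _ _ (\int[mu]_(x in Rp) ((phi x * e x)%:E + ((H * e x)%:E + tail (modulus t) N x)))%E).
    apply: ge0_le_integral => //.
    - by move=> x _; rewrite lee_fin mulr_ge0 ?modulus_ge0.
    - apply/measurable_EFinP; apply: measurable_funM => //.
      have := @measurable_modulus_line R (horner (P N)) 0 th Rp.
      rewrite (_ : (fun x : R => modulus (P N).[0 + x%:C * th]) = (fun x : R => modulus (P N).[x%:C * th])); last first.
        by apply/funext => x; rewrite add0r.
      by apply => x; exact: continuous_horner_numField.
    - by apply: emeasurable_funD => //; apply: emeasurable_funD.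
    move=> x Rx; have x0 : 0 < x by move: Rx; rewrite /= in_itv /= andbT.
    have := tail_pointwise t N th1 x0.
    set zz := t + _; set A := modulus _ => hA.
    apply: (@le_trans _ _ ((phi x * e x)%:E + ((H * e x)%:E + (A * e x)%:E))%E); last first.
      by rewrite leeD2l// leeD2l.
    rewrite -!EFinD lee_fin -!mulrDl ler_wpM2r// PE -/zz.
    (* Three sources of error: the given expansion of [F], the gap between [F] and the entire
       function, and the truncation of the latter. *)
    rewrite [X in modulus X](_ : _ = (F zz - \sum_(j < k) d j / j`!%:R * (x%:C * th) ^+ j) +
      (- (F zz - egf a zz) + - (egf a zz - part N zz))); last by ring.
    apply: le_trans (modulusD _ _) _; rewrite lerD2l.
    apply: le_trans (modulusD _ _) _; rewrite !modulusN lerD2r.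
    exact: hHt.
  rewrite ge0_integralD//; last 2 first.
  - by move=> x Rx; apply: adde_ge0; [rewrite lee_fin mulr_ge0|exact: tail0].
  - exact: emeasurable_funD.
  rewrite ge0_integralD//; last by move=> x Rx; rewrite lee_fin mulr_ge0.
  rewrite [X in (_ <= X)%E](_ : _ = (B%:E + ((H / (2 * pi))%:E + (tau (modulus t) N)%:E))%E); last first.
    by rewrite -!EFinD addrA.
  apply: leeD; first exact: hB.
  apply: leeD; last by apply: integral_tail; exact: modulus_ge0.
  have := @integral_powexp R (2 * pi) 0 lam0; rewrite fact0 expr1 div1r => h.
  have -> : (\int[mu]_(x in Rp) (H * e x)%:E = \int[mu]_(x in Rp) (H%:E * (x ^+ 0 * expR (- (2 * pi) * x))%:E))%E.
    by apply: eq_integral => x _; rewrite expr0 mul1r.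
  rewrite ge0_integralZl_EFin// ?h//.
  - by move=> x _; rewrite lee_fin expr0 mul1r expR_ge0.
  - by apply/measurable_EFinP; exact: measurable_powexp.
  by move=> x _; rewrite lee_fin mulr_ge0 ?modulus_ge0.
have bound N : modulus (series (fun n => a n * (appell R n).[t]) N -
    \sum_(j < k) d j * (euler_coef R j)%:C) <=
    2 * (B1 + B2) + 4 * (H / (2 * pi)) + 4 * tau (modulus t) N.
  rewrite -LP.
  have cFm (x : R) : {for t + (x%:C : C) * - i, continuous F}.
    by have := cF (- x); rewrite rmorphN mulrN mulNr.
  have hHm (x : R) : modulus (F (t + (x%:C : C) * - i) - egf a (t + (x%:C : C) * - i)) <= H.
    by have := hH (- x); rewrite rmorphN mulrN mulNr.
  have i1m : modulus (- i) = 1 by rewrite modulusN.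
  apply: le_trans (euler_fun_bound (aux N i B1 i1 cF hH hB1) (aux N (- i) B2 i1m cFm hHm hB2)) _.
  by rewrite le_eqVlt; apply/orP; left; apply/eqP; ring.
have tau0 : tau (modulus t) @ \oo --> (0 : R).
  rewrite -(mulr0 (expR (lam * modulus t) / lam)); apply: cvgM; first exact: cvg_cst.
  rewrite -(subrr (limn (series (fun n => (2 * pi) ^- n * modulus (a n))))).
  by apply: cvgB; [exact: cvg_cst|exact: sa].
set X := limn _ - _; set B := 2 * _ + _.
have cX : (fun N => modulus (series (fun n => a n * (appell R n).[t]) N -
    \sum_(j < k) d j * (euler_coef R j)%:C)) @ \oo --> modulus X.
  have h : (fun N => series (fun n => a n * (appell R n).[t]) N -
    \sum_(j < k) d j * (euler_coef R j)%:C) @ \oo --> X.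
    by apply: cvgB; [exact: (@cvgn_appell_series t)|exact: cvg_cst].
  apply/cvgrPdist_le => eps eps0; near=> N.
  apply: le_trans (modulus_dist _ _) _; rewrite modulusBC.
  rewrite -[modulus _]ger0_norm ?modulus_ge0// -normrN -sub0r.
  by near: N; move/cvgC_modulus/cvgrPdist_le : h; exact.
have cB : (fun N => B + 4 * tau (modulus t) N) @ \oo --> B.
  rewrite -[X in _ --> X]addr0; apply: cvgD; first exact: cvg_cst.
  by rewrite -(mulr0 4); apply: cvgM => //; exact: cvg_cst.
rewrite -(cvg_lim _ cX)// -(cvg_lim _ cB)//.
apply: ler_lim; [by apply/cvg_ex; eexists; exact: cX|by apply/cvg_ex; eexists; exact: cB|].
by apply: nearW => N; exact: bound.
Unshelve. all: by end_near. Qed.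

End AppellSeries.

(** * Asymptotics in the right half plane *)

Section Derivatives.
Variable R : realType.
Local Notation C := (Cplx R).
Local Notation H := (@right_half_plane R).

Lemma is_derive_of_quadratic (f : C -> C) (z d : C) (r K : R) : 0 < r ->
  (forall h : C, modulus h < r -> modulus (f (z + h) - f z - h * d) <= K * modulus h ^+ 2) ->
  is_derive z 1 f d.
Proof.
move=> r0 hf.
have lim : (fun h : C => h^-1 *: ((f \o shift z) (h *: 1) - f z)) @ 0^' --> d.
  apply/cvgrPdist_le => e e0.
  have [eI eR] : complex.Im e = 0 /\ 0 < complex.Re e.
    by move: e0; rewrite ltcE => /andP[/eqP -> ->].
  pose d0 : R := Num.min r (complex.Re e / (`|K| + 1)).
  have K1 : 0 < `|K| + 1 by rewrite ltr_wpDl.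
  have d00 : 0 < d0 by rewrite lt_min r0 divr_gt0.
  near=> h.
  have hn0 : h != 0 by near: h; exact: nbhs_dnbhs_neq.
  have hd : modulus h < d0.
    have : `|h| < (d0%:C : C) by near: h; apply: dnbhs0_lt; rewrite ltcR.
    by rewrite modulusE ltcR.
  have m0 : 0 < modulus h.
    by rewrite lt_def modulus_ge0 andbT; apply: contra_neq hn0; exact: modulus_eq0.
  rewrite modulusE lecE eI /= eqxx /=.
  have -> : d - h^-1 *: ((f \o shift z) (h *: 1) - f z) = - (h^-1 * (f (z + h) - f z - h * d)).
    by rewrite /GRing.scale /= mulr1 [h + z]addrC; field.
  rewrite modulusN modulusM modulusV ler_pdivrMl//.
  move: hd; rewrite lt_min => /andP[hr he].
  apply: le_trans (hf _ hr) _; rewrite expr2 mulrCA ler_wpM2l ?modulus_ge0//.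
  apply: (@le_trans _ _ ((`|K| + 1) * modulus h)).
    by rewrite ler_wpM2r ?modulus_ge0// (le_trans (ler_norm K))// lerDl.
  by rewrite mulrC -ler_pdivlMr// ltW.
apply: DeriveDef; first by apply/cvg_ex; exists d; exact: lim.
exact: (cvg_lim _ lim).
Unshelve. all: by end_near. Qed.

Lemma is_derive_qderiv (u v : C -> C) (z : C) : qderiv u v -> is_derive z 1 u (v z).
Proof.
move=> h; have [K hK] := h (modulus z + 1).
apply: (@is_derive_of_quadratic _ _ _ 1 K) => // k k1.
apply: hK; first by rewrite lerDl.
by rewrite (le_trans (ltW k1))// lerDr modulus_ge0.
Qed.

Lemma near_right_half_plane (z : C) : H z -> \forall w \near z, H w.
Proof.
move=> Hz; exists ((complex.Re z)%:C : C); first by rewrite /= ltcR.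
move=> w; rewrite /ball /= modulusE ltcR => h.
rewrite /right_half_plane /=.
have : `|complex.Re (z - w)| < complex.Re z by apply: le_lt_trans h; exact: ler_Re_modulus.
rewrite ReD ReN ltr_norml => /andP[_]; rewrite ltrBlDr ltrDl //.
Qed.

Lemma right_half_plane_neq0 (z : C) : H z -> z != 0.
Proof. by move=> Hz; apply: contraTneq Hz => ->; rewrite /right_half_plane /= ltxx. Qed.

Lemma is_derive_invpow (z : C) n : z != 0 ->
  is_derive z 1 (fun w : C => w ^- n) (- n%:R * z ^- n.+1).
Proof.
move=> z0.
have dX : is_derive z 1 (fun w : C => w ^+ n) (n%:R * z ^+ n.-1).
  rewrite (_ : (fun w => w ^+ n) = (@id C) ^+ n); last by rewrite exprfctE.
  apply: (is_derive_eq (is_deriveX n (is_derive_id z 1))).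
  by rewrite /GRing.scale /= mulr1.
have zn0 : z ^+ n != 0 by rewrite expf_neq0.
have [dX1 dX2] := dX.
pose F := fun w : C => w ^+ n.
apply: DeriveDef; first exact: (@derivableV _ _ F z 1 zn0 dX1).
rewrite (@deriveV _ _ F z 1 zn0 dX1) dX2 /F /GRing.scale /=.
case: n zn0 {dX dX1 dX2 F} => [|n] zn0; first by rewrite mul0r mulr0 oppr0 mul0r.
have zn : z ^+ n != 0 by rewrite expf_neq0.
rewrite !mulNr mulrCA; congr (- (_ * _)).
rewrite ![z ^+ _.+1]exprS /=; move: (z ^+ n) zn => y y0.
by field; rewrite z0 y0.
Qed.

Variables (M : nat) (b a : nat -> C) (f : C -> C).
Hypothesis aB : exp_bounded (2 * pi) a.
Hypothesis hf : forall z, H z -> f z = \sum_(1 <= m < M.+1) b m * z ^- m + egf a z.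

(** The signed rising factorial [(-1)^j m (m + 1) ... (m + j - 1)] from differentiating [z^-m] [j]
    times. *)
Fixpoint invpow_coef (m j : nat) : C :=
  if j is i.+1 then - (m + i)%:R * invpow_coef m i else 1.

Definition principal_part (j : nat) (z : C) : C :=
  \sum_(1 <= m < M.+1) b m * (invpow_coef m j * z ^- (m + j)).

Lemma is_derive_principal_part j (z : C) : H z ->
  is_derive z 1 (principal_part j) (principal_part j.+1 z).
Proof.
move=> Hz; rewrite /principal_part; move: (index_iota 1 M.+1) => r.
elim: r => [|m r IH].
  rewrite big_nil (_ : (fun w => _) = cst 0); first exact: is_derive_cst.
  by apply/funext => w; rewrite big_nil.
rewrite big_cons (_ : (fun w => _) = (fun w => b m * (invpow_coef m j * w ^- (m + j))) +
  (fun w => \sum_(i <- r) b i * (invpow_coef i j * w ^- (i + j)))); last first.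
  by apply/funext => w; rewrite big_cons.
apply: is_deriveD => //.
apply: (is_derive_eq (is_deriveZ (b m) (is_deriveZ (invpow_coef m j) (is_derive_invpow (m + j) (right_half_plane_neq0 Hz))))).
by rewrite /GRing.scale /= addnS; congr (_ * _); rewrite mulrA [invpow_coef m j * _]mulrC.
Qed.

Lemma exp_bounded_addn j : exp_bounded (2 * pi) (fun n => a (n + j)%N).
Proof.
elim: j => [|j IH].
  by rewrite (_ : (fun n => _) = a)//; apply/funext => n; rewrite addn0.
have := exp_bounded_shift (ltW (mul2pi_gt0 R)) IH.
by rewrite (_ : (fun n => a (n.+1 + j)%N) = (fun n => a (n + j.+1)%N))//; apply/funext => n; rewrite addSnnS.
Qed.

Lemma qderiv_egf_addn j :
  qderiv (egf (fun n => a (n + j)%N)) (egf (fun n => a (n + j.+1)%N)).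
Proof.
have := qderiv_egf (ltW (mul2pi_gt0 R)) (exp_bounded_addn j).
by rewrite (_ : (fun n => a (n.+1 + j)%N) = (fun n => a (n + j.+1)%N))//; apply/funext => n; rewrite addSnnS.
Qed.

Lemma derive1n_decomp j (z : C) : H z ->
  derive1n j f z = egf (fun n => a (n + j)%N) z + principal_part j z.
Proof.
elim: j z => [|j IH] z Hz.
  rewrite derive1n0 hf// addrC (_ : (fun n => a (n + 0)%N) = a); last by apply/funext => n; rewrite addn0.
  congr (_ + _); apply: eq_bigr => m _; by rewrite addn0 mul1r.
rewrite derive1nS derive1E.
(* The decomposition is known only on the half plane; its openness suffices for differentiating
   there. *)
rewrite (near_eq_derive _ (g := egf (fun n => a (n + j)%N) + principal_part j)); last first.
  by apply: filterS (near_right_half_plane Hz) => w; exact: IH.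
have [_ ->] // := is_deriveD (is_derive_qderiv z (qderiv_egf_addn j)) (is_derive_principal_part j Hz).
Qed.

Lemma principal_part_bound j : exists2 K : R, 0 <= K & forall z, 1 <= complex.Re z ->
  modulus (principal_part j z) <= K / complex.Re z.
Proof.
exists (\sum_(1 <= m < M.+1) modulus (b m) * modulus (invpow_coef m j)).
  by apply: sumr_ge0 => m _; rewrite mulr_ge0 ?modulus_ge0.
move=> z z1; rewrite mulr_suml; apply: le_trans (modulus_sum _ _ _) _.
apply: ler_sum_nat => m /andP[m1 _].
rewrite !modulusM -mulrA ler_wpM2l ?modulus_ge0// ler_wpM2l ?modulus_ge0//.
rewrite modulusV modulusX.
have x0 : 0 < complex.Re z by rewrite (lt_le_trans ltr01).
have xz : complex.Re z <= modulus z by apply: le_trans (ler_Re_modulus z); exact: ler_norm.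
have z0 := lt_le_trans x0 xz.
rewrite lef_pV2 ?posrE ?exprn_gt0// (le_trans xz)//.
rewrite -{1}[modulus z]expr1 ler_weXn2l// ?(le_trans z1)//.
by rewrite addn_gt0 m1.
Qed.

Lemma continuous_right_half_plane (z : C) : H z -> {for z, continuous f}.
Proof.
move=> Hz; apply: differentiable_continuous; apply/derivable1_diffP.
have hd := is_deriveD (is_derive_qderiv z (qderiv_egf_addn 0)) (is_derive_principal_part 0 Hz).
apply: (@near_eq_derivable _ _ _ (egf (fun n => a (n + 0)%N) + principal_part 0)).
  apply: filterS (near_right_half_plane Hz) => w Hw.
  by have := derive1n_decomp 0 Hw; rewrite derive1n0 => ->.
by case: hd.
Qed.

End Derivatives.

Section LocallyUniform.
Variable R : realType.
Local Notation C := (Cplx R).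
Local Notation mu := (@lebesgue_measure R).
Local Notation Rp := (`]0, +oo[%classic : set R).

Lemma cvg0_locally_uniformly_near (F : R -> R -> \bar R) (y e : R) : 0 < e ->
  cvg0_locally_uniformly F -> \forall x \near +oo, (`|F x y| < e%:E)%E.
Proof.
move=> e0 hF; have [V nV hV] := hF y.
by apply: filterS (hV e e0) => x; apply; exact: nbhs_singleton.
Qed.

(** Compactness of the segment makes a locally uniform limit uniform on it. *)
Lemma cvg0_locally_uniformly_segment (F : R -> R -> \bar R) (r e : R) : 0 < e ->
  cvg0_locally_uniformly F ->
  \forall x \near +oo, forall y, - r <= y <= r -> (`|F x y| < e%:E)%E.
Proof.
move=> e0 hF.
have /compact_near_coveringP cK := @segment_compact R (- r) r.
have := cK R (pinfty_nbhs R) (fun x y => (`|F x y| < e%:E)%E) (@filter_filter R _ proper_pinfty_nbhs).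
have h : forall y, `[- r, r]%classic y ->
    \forall y' \near y & x \near +oo, (`|F x y'| < e%:E)%E.
  move=> y _; have [V nV hV] := hF y.
  exists (V, [set x | forall y, V y -> (`|F x y| < e%:E)%E]).
    by split => //=; exact: hV.
  by move=> [y' x] [/= Vy' hx]; exact: hx.
move=> /(_ h); apply: filterS => x hx y hy; apply: hx.
by rewrite /= in_itv.
Qed.

Lemma cvgn_of_nneseries_lty (u : nat -> R) : (forall n, 0 <= u n) ->
  (\sum_(0 <= n <oo) (u n)%:E < +oo)%E -> cvgn (series u).
Proof. by move=> u0 h; apply: nnseries_is_cvg. Qed.

Lemma integral_reflect (u : R -> R) : continuous u -> (forall x, 0 <= u x) ->
  (\int[mu]_(x in `]-oo, 0%R[) (u x)%:E = \int[mu]_(x in Rp) (u (- x))%:E)%E.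
Proof.
move=> cu u0.
have mu_ : measurable_fun [set: R] (fun x => (u (- x))%:E).
  apply/measurable_EFinP; apply: continuous_measurable_fun => x.
  by apply: (@continuous_comp _ _ _ (@GRing.opp R) u); [exact: opp_continuous|exact: cu].
rewrite integral_itv_obnd_cbnd; last exact: measurable_funTS.
rewrite ge0_integration_by_substitution0//; last by move=> x; rewrite lee_fin.
rewrite integral_itv_bndo_bndc; last first.
  by apply: measurable_funTS; apply/measurable_EFinP; exact: continuous_measurable_fun.
by apply: eq_integral => x _; rewrite opprK.
Qed.

End LocallyUniform.

Section Asymptotics.
Variable R : realType.
Local Notation C := (Cplx R).
Local Notation mu := (@lebesgue_measure R).
Local Notation Rp := (`]0, +oo[%classic : set R).
Local Notation H := (@right_half_plane R).

Lemma weight0 (c x : R) : weight c 0 x = expR (- c * x).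
Proof. by rewrite /weight powRr0 mulr1 mulNr. Qed.

Lemma real_mul_i (x : R) : (x%:C : C) * (0 +i* 1) = 0 +i* x.
Proof. by apply/eqP; rewrite eq_complex /= !mul0r !mulr0 mulr1 subrr addr0 !eqxx. Qed.

Lemma natr_addC n (w : C) : n%:R + w = (n%:R + complex.Re w) +i* complex.Im w.
Proof.
case: w => x y; rewrite natrC; apply/eqP; rewrite eq_complex /=.
by rewrite add0r !eqxx.
Qed.

Lemma pinfty_shift (P : R -> Prop) (c : R) :
  (\forall x \near +oo, P x) -> \forall n \near \oo, P (n%:R + c).
Proof.
move=> [A [_ hA]].
have : \forall n \near \oo, A - c < (n%:R : R).
  exact: nbhs_infty_gtr.
by apply: filterS => n h; apply: hA; rewrite -ltrBlDr.
Qed.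

Variables (M : nat) (b a : nat -> C) (f : C -> C) (p : nat).
Hypothesis sa : cvgn (series (fun n => (2 * pi) ^- n * modulus (a n))).
Hypothesis hf : forall z, H z -> f z = \sum_(1 <= m < M.+1) b m * z ^- m + egf a z.
Hypothesis hpos : vertical_condition p `]0, +oo[ (2 * pi) 0 f.
Hypothesis hneg : vertical_condition p `]-oo, 0[ (- (2 * pi)) 0 f.
Hypothesis hder : cvg0_locally_uniformly
  (fun t xi : R => (modulus (derive1n p f (t +i* xi)))%:E).

Let aB : exp_bounded (2 * pi) a := summable_exp_bounded sa.

Definition appell_series (t : C) : C := limn (series (fun n => a n * (appell R n).[t])).

Let ray_bound (t th : C) (e : R) : Prop :=
  (\int[mu]_(r in Rp) (modulus (f (t + (r%:C : C) * th) -
     \sum_(j < p) derive1n j f t / j`!%:R * ((r%:C : C) * th) ^+ j) * expR (- (2 * pi) * r))%:E <= e%:E)%E.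

Lemma right_half_plane_add_imag (t : C) (x : R) : H t -> H (t + (x%:C : C) * (0 +i* 1)).
Proof. by rewrite real_mul_i /right_half_plane /= ReD /= addr0. Qed.

(** With [k = l = 0] both weights are [exp (- 2 pi |xi|)], so reflecting the negative half-line
    gives the two rays that [appell_series_bound] uses. *)
Lemma taylor_integral_near (y e : R) : 0 < e ->
  \forall x \near +oo,
   ray_bound (x +i* y) (0 +i* 1) e /\ ray_bound (x +i* y) (- (0 +i* 1)) e.
Proof.
move=> e0.
have h1 := cvg0_locally_uniformly_near y e0 hpos.2.
have h2 := cvg0_locally_uniformly_near y e0 hneg.2.
near=> x.
have x0 : 0 < x by near: x; exact: nbhs_pinfty_gt.
have Ht : H (x +i* y) by [].
have h3 : (`|\int[mu]_(xi in Rp) (modulus (taylor_remainder p f (x +i* y) xi) * weight (2 * pi) 0 xi)%:E| < e%:E)%E.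
  by near: x; exact: h1.
have h4 : (`|\int[mu]_(xi in `]-oo, 0%R[) (modulus (taylor_remainder p f (x +i* y) xi) * weight (- (2 * pi)) 0 xi)%:E| < e%:E)%E.
  by near: x; exact: h2.
split.
  apply: le_trans (ltW (le_lt_trans (lee_abs _) h3)).
  rewrite le_eqVlt; apply/orP; left; apply/eqP; apply: eq_integral => r _.
  by rewrite /taylor_remainder weight0 real_mul_i.
apply: le_trans (ltW (le_lt_trans (lee_abs _) h4)).
rewrite le_eqVlt; apply/orP; left; apply/eqP.
pose t : C := x +i* y.
(* The Taylor polynomial is rewritten in the variable [t + z], so that the integrand is the modulus
   of a function of the moving point and its continuity follows from [continuous_modulus_line]. *)
pose q : {poly C} := (\sum_(j < p) (derive1n j f t / j`!%:R) *: 'X^j) \Po ('X - t%:P).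
pose u (r : R) := modulus (f (t + (r%:C : C) * (0 +i* 1)) -
  q.[t + (r%:C : C) * (0 +i* 1)]) * expR (2 * pi * r).
have qE z : q.[t + z] = \sum_(j < p) derive1n j f t / j`!%:R * z ^+ j.
  rewrite /q horner_comp hornerD hornerN hornerX hornerC [t + _]addrC addrK horner_sum.
  by apply: eq_bigr => j _; rewrite hornerZ hornerXn.
have cu : continuous u.
  move=> r; apply: cvgM.
    apply: (@continuous_modulus_line R (fun z => f z - q.[z])) => s.
    apply: (@continuousB _ _ _ f (horner q)); last exact: continuous_horner_numField.
    exact: (continuous_right_half_plane aB hf (right_half_plane_add_imag _ Ht)).
  apply: (@continuous_comp _ _ _ (fun y => 2 * pi * y) expR); last exact: continuous_expR.
  exact: mulrl_continuous.
have u0 r : 0 <= u r by rewrite /u mulr_ge0 ?modulus_ge0 ?expR_ge0.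
rewrite (_ : (\int[mu]_(xi in `]-oo, 0%R[) _ = \int[mu]_(xi in `]-oo, 0%R[) (u xi)%:E)%E); last first.
  by apply: eq_integral => r _; rewrite /u /taylor_remainder weight0 real_mul_i qE opprK.
rewrite integral_reflect//; apply: eq_integral => r _.
by rewrite /u qE rmorphN mulrN mulNr mulrN mulNr.
Unshelve. all: by end_near. Qed.

Lemma cvg_appell_series (w : C) :
  (fun n : nat => appell_series (n%:R + w) -
    \sum_(j < p) derive1n j f (n%:R + w) * (euler_coef R j)%:C) @ \oo --> (0 : C).
Proof.
have [K K0 hK] := principal_part_bound M b 0.
apply/cvgC_modulus; apply/cvgrPdist_le => e e0.
(* The final bound is [2 (e/8 + e/8) + 4 (e/8) / (2 pi)], at most [e] because [2 pi >= 1]. *)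
have e8 : 0 < e / 8 by rewrite divr_gt0.
have h := pinfty_shift (complex.Re w) (taylor_integral_near (complex.Im w) e8).
near=> n.
have nw := natr_addC n w.
have x1 : 1 <= n%:R + complex.Re w.
  near: n; apply: (@pinfty_shift (fun x => 1 <= x)); apply: nbhs_pinfty_ge; exact: num_real.
have x0 : 0 < n%:R + complex.Re w := lt_le_trans ltr01 x1.
have xK : K / (n%:R + complex.Re w) <= e / 8.
  have : 8 * K / e <= n%:R + complex.Re w.
    near: n; apply: (@pinfty_shift (fun x => 8 * K / e <= x)); apply: nbhs_pinfty_ge; exact: num_real.
  by rewrite ler_pdivrMr// => hh; rewrite ler_pdivrMr// mulrAC ler_pdivlMr//; lra.
have [h1 h2] : ray_bound ((n%:R + complex.Re w) +i* complex.Im w) (0 +i* 1) (e / 8) /\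
    ray_bound ((n%:R + complex.Re w) +i* complex.Im w) (- (0 +i* 1)) (e / 8).
  by near: n; exact: h.
rewrite subr0 sub0r normrN ger0_norm ?modulus_ge0//.
set t : C := n%:R + w; rewrite -/t -nw in h1 h2.
have Ht : H t by rewrite /t nw.
apply: le_trans (@appell_series_bound R a sa t f p (fun j => derive1n j f t) (e / 8) (e / 8) (e / 8) _ _ h1 h2) _.
- by move=> x; exact: (continuous_right_half_plane aB hf (right_half_plane_add_imag _ Ht)).
- move=> x; have := right_half_plane_add_imag x Ht; set z := t + _ => Hz.
  have Rz : complex.Re z = n%:R + complex.Re w.
    by rewrite /z real_mul_i ReD /= addr0 /t ReD Re_nat.
  have := derive1n_decomp aB hf 0 Hz; rewrite derive1n0 => ->.
  rewrite (_ : (fun n => a (n + 0)%N) = a); last by apply/funext => m; rewrite addn0.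
  rewrite addrC addKr; apply: le_trans (hK z _) _; first by rewrite Rz.
  by rewrite Rz.
have : e / 8 / (2 * pi) <= e / 8.
  by rewrite ler_piMr ?(ltW e8)// invf_le1 ?mul2pi_gt0//; have := pi_ge2 R; lra.
lra.
Unshelve. all: by end_near. Qed.

(** The decay of the [p]-th derivative of [f] passes to the entire part because the negative powers
    decay. It is uniform in [s]: the points [w + s y] have modulus at most [r], so imaginary parts
    stay in [[-r, r]] and real parts exceed [n - r]. *)
Lemma egf_deriv_segment (w y : C) (e : R) : 0 < e ->
  \forall n \near \oo, forall s : R, 0 <= s <= 1 ->
    modulus (egf (fun m => a (m + p)%N) (n%:R + w + s%:C * y)) <= e.
Proof.
move=> e0; have e2 : 0 < e / 2 by rewrite divr_gt0.
have [K K0 hK] := principal_part_bound M b p.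
pose r := modulus w + modulus y.
have [X [_ hX]] := cvg0_locally_uniformly_segment r e2 hder.
near=> n => s /andP[s0 s1].
set z := _ + _.
have zE : z = complex.Re z +i* complex.Im z by case: (z).
have sy : modulus (s%:C * y) <= modulus y.
  by rewrite modulusM modulus_real ger0_norm// ler_piMl ?modulus_ge0.
have wsy : modulus (w + s%:C * y) <= r by rewrite (le_trans (modulusD _ _))// lerD2l.
have Rz : n%:R - r <= complex.Re z.
  rewrite /z -addrA ReD Re_nat lerD2l.
  by have := le_trans (ler_Re_modulus _) wsy; rewrite ler_norml => /andP[].
have Iz : - r <= complex.Im z <= r.
  rewrite /z -addrA ImD Im_nat add0r -ler_norml.
  exact: le_trans (ler_Im_modulus _) wsy.
have z1 : 1 <= complex.Re z.
  apply: le_trans Rz; near: n; apply: (@pinfty_shift (fun x => 1 <= x)); apply: nbhs_pinfty_ge; exact: num_real.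
have zX : X < complex.Re z.
  apply: lt_le_trans Rz; near: n; apply: (@pinfty_shift (fun x => X < x)); apply: nbhs_pinfty_gt; exact: num_real.
have zK : 2 * K / e <= complex.Re z.
  apply: le_trans Rz; near: n; apply: (@pinfty_shift (fun x => 2 * K / e <= x)); apply: nbhs_pinfty_ge; exact: num_real.
have z0 : 0 < complex.Re z := lt_le_trans ltr01 z1.
have := hX _ zX _ Iz; rewrite -zE abse_EFin lte_fin ger0_norm ?modulus_ge0// => hd.
have hg := derive1n_decomp aB hf p (z0 : H z).
rewrite (_ : egf _ z = derive1n p f z - principal_part M b p z); last by rewrite hg addrK.
apply: le_trans (modulusB _ _) _; rewrite [e]splitr lerD ?(ltW hd)//.
apply: le_trans (hK z z1) _.
rewrite ler_pdivrMr//; move: zK; rewrite ler_pdivrMr// => hh; lra.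
Unshelve. all: by end_near. Qed.

Lemma cvg_deriv_egf (w : C) j :
  (fun n : nat => derive1n j f (n%:R + w) - egf (fun m => a (m + j)%N) (n%:R + w)) @ \oo --> (0 : C).
Proof.
have [K K0 hK] := principal_part_bound M b j.
apply: (@modulus_cvgS _ _ (fun n => K / (n%:R + complex.Re w))).
  near=> n.
  have x1 : 1 <= complex.Re (n%:R + w).
    rewrite ReD Re_nat.
    near: n; apply: (@pinfty_shift (fun x => 1 <= x)); apply: nbhs_pinfty_ge; exact: num_real.
  rewrite subr0 (derive1n_decomp aB hf j) ?/right_half_plane /= ?(lt_le_trans ltr01)//.
  rewrite addrC addKr; apply: le_trans (hK _ x1) _.
  by rewrite ReD Re_nat.
rewrite -(mulr0 K); apply: cvgM; first exact: cvg_cst.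
apply/cvgrPdist_le => e e0; near=> n.
have xe : e^-1 <= n%:R + complex.Re w.
  near: n; apply: (@pinfty_shift (fun x => e^-1 <= x)); apply: nbhs_pinfty_ge; exact: num_real.
have ei : 0 < e^-1 by rewrite invr_gt0.
rewrite sub0r normrN ger0_norm ?invr_ge0 ?(le_trans (ltW ei))//.
by rewrite -[e]invrK lef_pV2 ?posrE ?(lt_le_trans ei).
Unshelve. all: by end_near. Qed.

End Asymptotics.

(** * Summation of the entire part *)

Section Assembly.
Variable R : realType.
Local Notation C := (Cplx R).
Local Notation H := (@right_half_plane R).

(** Telescoping makes the partial sums exact polynomials in [y], so the sequence in the definition
    is constant. *)
Lemma MS_realizes_monomial n (c : C) : exists P,
  MS_realizes H (fun k => c / n`!%:R * k ^+ n) P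
    (fun y => c * (euler_poly R n).[y + 2^-1]).
Proof.
set E := euler_poly R n.
have stepE z : c * E.[z + 1 + 2^-1] - c * E.[z + 2^-1] = c / n`!%:R * (z + 1) ^+ n.
  have := euler_poly_identity n (z + 1).
  rewrite (_ : z + 1 - 2^-1 = z + 2^-1); last by field.
  by rewrite -mulrBr => ->; rewrite mulrA mulrAC.
have telE y N : \sum_(1 <= k < N.+1) c / n`!%:R * (k%:R + y) ^+ n =
    c * E.[N%:R + y + 2^-1] - c * E.[y + 2^-1].
  elim: N => [|N IH]; first by rewrite big_geq// add0r subrr.
  have e : N.+1%:R + y = N%:R + y + 1 by rewrite -natr1 addrAC.
  by rewrite big_nat_recr//= IH e -stepE [LHS]addrC addrA subrK.
move: E stepE telE => E stepE telE.
(* The constant [c * E.[2^-1]] compensates for the chosen [Q], which need not vanish at [0]. *)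
exists (fun N => c *: (E \Po ('X + (N%:R + 2^-1)%:P)) -
  (c * E.[N%:R + 2^-1] - c * E.[2^-1])%:P); split.
- exists (maxn (size E) 1) => N.
  rewrite (leq_trans (size_polyD _ _))// geq_max size_polyN; apply/andP; split.
    rewrite (leq_trans (size_scale_leq _ _))// leq_max; apply/orP; left.
    by rewrite size_comp_poly2// size_XaddC.
  by rewrite (leq_trans (size_polyC_leq1 _))// leq_maxr.
- move=> y _; apply: cvg_congr (cvg_cst (- (c * E.[y + 2^-1]))) => // N.
  under eq_bigr do rewrite -[X in _ - c / _ * X ^+ _]addr0.
  rewrite sumrB !telE hornerD hornerN hornerC hornerZ horner_comp hornerD hornerX hornerC.
  rewrite (_ : y + (N%:R + 2^-1) = N%:R + y + 2^-1); last by ring.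
  by rewrite addr0 add0r /cst; ring.
- by move=> y _; exact: stepE.
Qed.

Variables (M : nat) (b a : nat -> C) (f : C -> C) (p : nat).
Hypothesis sa : cvgn (series (fun n => (2 * pi) ^- n * modulus (a n))).
Hypothesis hf : forall z, H z -> f z = \sum_(1 <= m < M.+1) b m * z ^- m + egf a z.
Hypothesis hpos : vertical_condition p `]0, +oo[ (2 * pi) 0 f.
Hypothesis hneg : vertical_condition p `]-oo, 0[ (- (2 * pi)) 0 f.
Hypothesis hder : cvg0_locally_uniformly
  (fun t xi : R => (modulus (derive1n p f (t +i* xi)))%:E).

Let aB : exp_bounded (2 * pi) a := summable_exp_bounded sa.

Let a' (n : nat) : C := if n is m.+1 then a m else 0.

Let a'B : exp_bounded (2 * pi) a' := exp_bounded_unshift (mul2pi_gt0 R) aB.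

Definition entire_sum (y : C) : C :=
  limn (series (fun n => a n * (euler_poly R n).[y + 2^-1])).

Let cvg_euler_series y : series (fun n => a n * (euler_poly R n).[y + 2^-1]) @ \oo -->
  egf a' (y + 2^-1) + appell_series a (y + 2^-1).
Proof.
have h1 : series (fun n => a n * ((y + 2^-1) ^+ n.+1 / n.+1`!%:R)) @ \oo --> egf a' (y + 2^-1).
  have [A A0 hA] := a'B.
  have := @cvgn_egf R (2 * pi) A a' hA (y + 2^-1); rewrite -(cvg_shiftn 1) => h.
  apply: cvg_congr h => // n; rewrite /= addn1 /series /= big_nat_recl//=.
  by rewrite !mul0r add0r; apply: eq_bigr => i _; rewrite mulrAC mulrA.
have h2 : series (fun n => a n * (appell R n).[y + 2^-1]) @ \oo --> appell_series a (y + 2^-1).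
  exact: (@cvgn_appell_series R a sa (y + 2^-1)).
have e n : series (fun n => a n * (euler_poly R n).[y + 2^-1]) n =
    series (fun n => a n * ((y + 2^-1) ^+ n.+1 / n.+1`!%:R)) n +
    series (fun n => a n * (appell R n).[y + 2^-1]) n.
  rewrite /series /= -big_split /=; apply: eq_bigr => i _.
  by rewrite horner_euler_poly mulrDr.
exact: cvg_congr (fun n => esym (e n)) erefl (cvgD h1 h2).
Qed.

Let entire_sumE y : entire_sum y = egf a' (y + 2^-1) + appell_series a (y + 2^-1).
Proof. exact: (cvg_lim _ (@cvg_euler_series y)). Qed.

Lemma cvg_entire_sum y :
  series (fun n => a n * (euler_poly R n).[y + 2^-1]) @ \oo --> entire_sum y.
Proof. by rewrite entire_sumE; exact: cvg_euler_series. Qed.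

Let entire_sum_step y : entire_sum (y + 1) - entire_sum y = egf a (y + 1).
Proof.
have e n : series (fun n => a n * (euler_poly R n).[y + 1 + 2^-1]) n -
    series (fun n => a n * (euler_poly R n).[y + 2^-1]) n =
    series (fun n => a n / n`!%:R * (y + 1) ^+ n) n.
  rewrite /series /= -sumrB; apply: eq_bigr => i _.
  have := euler_poly_identity i (y + 1).
  rewrite (_ : y + 1 - 2^-1 = y + 2^-1); last by field.
  by rewrite -mulrBr => ->; rewrite mulrA mulrAC.
have h : series (fun n => a n / n`!%:R * (y + 1) ^+ n) @ \oo -->
    entire_sum (y + 1) - entire_sum y.
  by apply: cvg_congr (cvgB (@cvg_entire_sum (y + 1)) (@cvg_entire_sum y)) => // n; exact: e.
by rewrite /egf (cvg_lim _ h).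
Qed.

(* [U 0] is a primitive of [egf a], and [U j.+1] its [j]-th derivative. *)
Let U (j : nat) : C -> C := if j is i.+1 then egf (fun n => a (n + i)%N) else egf a'.

Let qderivU j : qderiv (U j) (U j.+1).
Proof.
case: j => [|j]; last exact: qderiv_egf_addn.
rewrite /= (_ : (fun n => a (n + 0)%N) = (fun n => a' n.+1)).
  exact: qderiv_egf (ltW (mul2pi_gt0 R)) a'B.
by apply/funext => n; rewrite addn0.
Qed.

Let cent (n : nat) : C := n%:R + 2^-1.

(** Every expansion stops just before [U p.+1], the [p]-th derivative of [egf a], which is small on
    the segment from [cent n] to [cent n + y]. At [j = p.+1] the sum is empty. *)
Let cvg_taylorU (y : C) (j : nat) : (j <= p.+1)%N ->
  (fun n => U j (cent n + y) - \sum_(i < p.+1 - j) U (j + i) (cent n) * (y ^+ i / i`!%:R))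
  @ \oo --> (0 : C).
Proof.
move=> jp; apply/cvgC_modulus; apply/cvgrPdist_le => e e0.
pose Y := modulus y ^+ (p.+1 - j).
have Y0 : 0 <= Y by rewrite exprn_ge0 ?modulus_ge0.
have d0 : 0 < e / (Y + 1) by rewrite divr_gt0// ltr_wpDl.
have hseg := egf_deriv_segment sa hf hder 2^-1 y d0.
near=> n.
have hs : forall s : R, 0 <= s <= 1 ->
    modulus (egf (fun m => a (m + p)%N) (n%:R + 2^-1 + s%:C * y)) <= e / (Y + 1).
  by near: n; exact: hseg.
have := @qderiv_taylor R (p.+1 - j) (fun i => U (j + i)%N) (cent n) y _ (ltW d0).
rewrite subr0 sub0r normrN ger0_norm ?modulus_ge0// => h.
have hq : forall s : R, 0 <= s <= 1 ->
    modulus (U (j + (p.+1 - j)) (cent n + s%:C * y)) <= e / (Y + 1).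
  by move=> s hs1; rewrite subnKC//; exact: hs.
have hU i : qderiv (U (j + i)%N) (U (j + i.+1)%N) by rewrite addnS; exact: qderivU.
have {}h := h hU hq 1 _; rewrite addn0 mul1r in h.
apply: le_trans (h _) _; first by rewrite ler01 lexx.
rewrite mulrAC ler_pdivrMr ?ltr_wpDl// ler_wpM2l ?(ltW e0)//.
by rewrite -/Y lerDl.
Unshelve. all: by end_near. Qed.

Let ec (j : nat) : C := (euler_coef R j)%:C.

(** Replaces the derivatives of [f] by those of [egf a], which, unlike those of the negative powers,
    come with a Taylor formula on the whole plane. *)
Let cvg_appellU (w : C) :
  (fun n : nat => appell_series a (n%:R + w) - \sum_(j < p) U j.+1 (n%:R + w) * ec j)
  @ \oo --> (0 : C).
Proof.
have h1 := cvg_appell_series sa hf hpos hneg w.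
have h2 : (fun n : nat => \sum_(j < p) (derive1n j f (n%:R + w) -
    egf (fun m => a (m + j)%N) (n%:R + w)) * ec j) @ \oo --> \sum_(j < p) (0 * ec j : C).
  apply: (@cvg_sum _ _ _ _ (fun (j : 'I_p) (n : nat) => (derive1n j f (n%:R + w) -
    egf (fun m => a (m + j)%N) (n%:R + w)) * ec j) (fun j => 0 * ec j)) => j.
  by apply: cvgM; [exact: (cvg_deriv_egf sa hf)|exact: cvg_cst].
apply: cvg_congr (cvgD h1 h2).
  move=> n; rewrite -[LHS]/(appell_series a (n%:R + w) -
    \sum_(j < p) derive1n j f (n%:R + w) * (euler_coef R j)%:C +
    \sum_(j < p) (derive1n j f (n%:R + w) - egf (fun m => a (m + j)%N) (n%:R + w)) * ec j).
  rewrite -addrA; congr (_ + _).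
  rewrite -!sumrN -big_split /=; apply: eq_bigr => j _; rewrite /ec; ring.
by rewrite add0r big1// => j _; rewrite mul0r.
Qed.

(* The Taylor polynomial of [entire_sum] at [n], re-centred so that its value
   at [0] is [entire_sum 0], with the series of Appell polynomials replaced by
   its asymptotic expansion in the derivatives of [egf a]. *)
Definition MS_poly (n : nat) : {poly C} :=
  \sum_(i < p) (U i.+1 (cent n) / i.+1`!%:R) *: 'X^(i.+1) +
  \sum_(j < p) ec j *: (\sum_(i < p - j) (U (j.+1 + i) (cent n) / i`!%:R) *: 'X^i) -
  (\sum_(j < p) U j.+1 (cent n) * ec j - entire_sum 0)%:P.

Let size_monoms (r : nat) (c : nat -> C) (e : nat -> nat) d :
  (forall i, (i < r)%N -> (e i < d)%N) ->
  (size (\sum_(i < r) c i *: 'X^(e i))%R <= d)%N.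
Proof.
move=> h; apply: (leq_trans (size_sum _ _ _)); apply/bigmax_leqP => i _.
by rewrite (leq_trans (size_scale_leq _ _))// size_polyXn; exact: h.
Qed.

Let size_MS_poly n : (size (MS_poly n) <= p.+1)%N.
Proof.
rewrite /MS_poly (leq_trans (size_polyD _ _))// geq_max size_polyN.
rewrite (leq_trans (size_polyC_leq1 _))// andbT.
rewrite (leq_trans (size_polyD _ _))// geq_max; apply/andP; split.
  exact: (@size_monoms p (fun i => U i.+1 (cent n) / i.+1`!%:R) (fun i => i.+1)).
apply: (leq_trans (size_sum _ _ _)); apply/bigmax_leqP => j _.
rewrite (leq_trans (size_scale_leq _ _))//.
apply: (@size_monoms (p - j) (fun i => U (j.+1 + i)%N (cent n) / i`!%:R) id) => i.
by move=> ij; rewrite ltnS (leq_trans (ltnW ij))// leq_subr.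
Qed.

(** Four approximations are added: Taylor for the primitive [U 0], the Appell series at
    [cent n + y], Taylor for the derivatives it produces, and the Appell series at [cent n]. The
    zeroth Taylor term [U 0 (cent n)] cancels against [entire_sum n%:R], so only a polynomial
    without it remains. *)
Let cvg_entire_increment (y : C) :
  (fun n : nat => entire_sum (n%:R + y) - entire_sum n%:R + entire_sum 0 - (MS_poly n).[y])
  @ \oo --> (0 : C).
Proof.
have hG := cvg_taylorU y (leq0n p.+1).
have hT := cvg_appellU (2^-1 + y).
have hT0 := cvg_appellU 2^-1.
have hS : (fun n : nat => \sum_(j < p) (U j.+1 (cent n + y) -
    \sum_(i < p - j) U (j.+1 + i) (cent n) * (y ^+ i / i`!%:R)) * ec j) @ \oo -->
    \sum_(j < p) (0 * ec j : C).
  apply: (@cvg_sum _ _ _ _ (fun (j : 'I_p) (n : nat) => (U j.+1 (cent n + y) -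
    \sum_(i < p - j) U (j.+1 + i) (cent n) * (y ^+ i / i`!%:R)) * ec j) (fun j => 0 * ec j)) => j.
  apply: cvgM; last exact: cvg_cst.
  by have := @cvg_taylorU y j.+1 (leqW (ltn_ord j)); rewrite subSS.
apply: cvg_congr (cvgB (cvgD (cvgD hG hT) hS) hT0); last first.
  by rewrite !add0r subr0 big1// => j _; rewrite mul0r.
move=> n; set c := cent n.
pose X1 := \sum_(i < p) U i.+1 c / i.+1`!%:R * y ^+ i.+1.
pose X2 := \sum_(j < p) ec j * \sum_(i < p - j) U (j.+1 + i)%N c / i`!%:R * y ^+ i.
have F1 : \sum_(i < p.+1 - 0) U (0 + i)%N c * (y ^+ i / i`!%:R) = U 0 c + X1.
  rewrite subn0 big_ord_recl /= expr0 fact0 divr1 mulr1; congr (_ + _).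
  by apply: eq_bigr => i _; rewrite mulrA mulrAC.
have F2 : \sum_(j < p) (U j.+1 (c + y) -
    \sum_(i < p - j) U (j.+1 + i)%N c * (y ^+ i / i`!%:R)) * ec j =
    \sum_(j < p) U j.+1 (c + y) * ec j - X2.
  rewrite /X2 -sumrB; apply: eq_bigr => j _; rewrite mulrBl; congr (_ - _).
  by rewrite mulrC; congr (_ * _); apply: eq_bigr => i _; rewrite mulrA mulrAC.
have F3 : (MS_poly n).[y] = X1 + X2 - (\sum_(j < p) U j.+1 c * ec j - entire_sum 0).
  rewrite /MS_poly hornerD hornerN hornerC hornerD !horner_sum; congr (_ + _ - _).
    by apply: eq_bigr => i _; rewrite hornerZ hornerXn.
  apply: eq_bigr => j _; rewrite hornerZ horner_sum; congr (_ * _).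
  by apply: eq_bigr => i _; rewrite hornerZ hornerXn.
rewrite F3 [entire_sum (n%:R + y)]entire_sumE.
have e1 : n%:R + (2^-1 + y) = c + y by rewrite addrA.
have e2 : n%:R + y + 2^-1 = c + y by rewrite addrAC.
rewrite -[LHS]/(U 0 (c + y) - \sum_(i < p.+1 - 0) U (0 + i)%N c * (y ^+ i / i`!%:R) +
  (appell_series a (n%:R + (2^-1 + y)) - \sum_(j < p) U j.+1 (n%:R + (2^-1 + y)) * ec j) +
  (\sum_(j < p) (U j.+1 (c + y) - \sum_(i < p - j) U (j.+1 + i)%N c * (y ^+ i / i`!%:R)) * ec j) -
  (appell_series a c - \sum_(j < p) U j.+1 c * ec j)).
rewrite F1 F2 e1 [entire_sum n%:R]entire_sumE e2 -[n%:R + 2^-1]/c -[egf a']/(U 0).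
have alg (u u0 v v0 A B s x1 x2 : C) : u - (u0 + x1) + (v - A) + (A - x2) - (v0 - B) =
    u + v - (u0 + v0) + s - (x1 + x2 - (B - s)) by ring.
exact: alg.
Qed.

Let sum_egf (y : C) N : \sum_(1 <= k < N.+1) (egf a (k%:R + y) - egf a k%:R) =
  (entire_sum (N%:R + y) - entire_sum N%:R + entire_sum 0) - entire_sum y.
Proof.
elim: N => [|N IH]; first by rewrite big_geq// add0r subrK subrr.
rewrite big_nat_recr//= IH.
have e1 : N.+1%:R + y = N%:R + y + 1 by rewrite -natr1 addrAC.
have e2 : (N.+1%:R : C) = N%:R + 1 by rewrite -natr1.
rewrite e1 e2 -!entire_sum_step.
have alg (u u' v v' s t : C) : u - v + s - t + (u' - u - (v' - v)) = u' - v' + s - t by ring.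
exact: alg.
Qed.

Let H_nat_add (k : nat) (y : C) : (0 < k)%N -> H (y + 1) -> H (k%:R + y).
Proof.
case: k => // k _; rewrite /right_half_plane /= !ReD Re_nat -natr1 /= => h.
by rewrite -addrA [1 + _]addrC ltr_wpDl.
Qed.

Let H_nat (k : nat) : (0 < k)%N -> H (k%:R).
Proof. by move=> k0; rewrite /right_half_plane /= Re_nat ltr0n. Qed.

Lemma MS_realizes_sum (Qm : nat -> C -> C) :
  (forall m, (0 < m)%N -> MS_realizes H (fun k => b m * k ^- m) (fun=> 0) (Qm m)) ->
  MS_realizes H f MS_poly (fun y => \sum_(1 <= m < M.+1) Qm m y + entire_sum y).
Proof.
move=> hQ; split.
- by exists p.+1 => n; exact: size_MS_poly.
- move=> y Hy.
  have h1 : (fun N => \sum_(1 <= m < M.+1) (\sum_(1 <= k < N.+1)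
      (b m * (k%:R + y) ^- m - b m * k%:R ^- m))) @ \oo --> \sum_(1 <= m < M.+1) (- Qm m y).
    rewrite !big_add1 /=; under eq_fun do rewrite big_add1 /=.
    apply: (@cvg_sum _ _ _ _ (fun m N => \sum_(1 <= k < N.+1)
      (b m.+1 * (k%:R + y) ^- m.+1 - b m.+1 * k%:R ^- m.+1)) (fun m => - Qm m.+1 y)) => m.
    have [_ h _] := hQ m.+1 (ltn0Sn m).
    by apply: cvg_congr (h y Hy) => // N; rewrite horner0 subr0.
  apply: cvg_congr (cvgB (cvgD h1 (cvg_entire_increment y)) (cvg_cst (entire_sum y))); last first.
    by rewrite addr0 sumrN opprD.
  move=> N; rewrite /=.
  have -> : \sum_(1 <= k < N.+1) (f (k%:R + y) - f k%:R) =
     \sum_(1 <= m < M.+1) (\sum_(1 <= k < N.+1) (b m * (k%:R + y) ^- m - b m * k%:R ^- m)) +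
     \sum_(1 <= k < N.+1) (egf a (k%:R + y) - egf a k%:R).
    rewrite exchange_big /= -big_split /=; apply: eq_big_nat => k /andP[k1 _].
    by rewrite (hf (H_nat_add k1 Hy)) (hf (H_nat k1)) sumrB opprD addrACA.
  have alg (r u v t : C) : r + (u - v) - t = r + (u - t) - v by ring.
  by rewrite sum_egf; exact: alg.
- move=> y Hy; rewrite opprD addrACA -sumrB entire_sum_step hf//; congr (_ + _).
  apply: eq_big_nat => m /andP[m1 _].
  by have [_ _ h] := hQ m m1; rewrite h.
Qed.

End Assembly.

(** * Termwise evaluation of the Mueller-Schleicher sum *)

Theorem corollary3p1 (R : realType) (M : nat) (b a : nat -> Cplx R)
    (f : Cplx R -> Cplx R)
    (hf : forall z : Cplx R, right_half_plane z ->
       cvgn (series (fun n => a n / (n`!)%:R * z ^+ n)) /\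
       f z = \sum_(1 <= m < M.+1) b m * z ^- m
             + limn (series (fun n => a n / (n`!)%:R * z ^+ n)))
    (hp : exists p : nat,
       [/\ class_T p (- (2 * pi)) 0 (2 * pi) 0 f,
           cvg0_locally_uniformly
             (fun t xi : R => (modulus (derive1n p f (t +i* xi)))%:E) &
           (\sum_(0 <= n <oo) ((2 * pi) ^- n * modulus (a n))%:E < +oo)%E]) :
  [/\ MS_summable right_half_plane f,
      forall m : nat, (1 <= m <= M)%N ->
        MS_summable right_half_plane (fun k => b m * k ^- m),
      forall n : nat,
        MS_summable right_half_plane (fun k => a n / (n`!)%:R * k ^+ n) &
      forall alpha beta : Cplx R,
        -1 < complex.Re alpha -> -1 < complex.Re beta ->
        cvgn (series (fun n =>
          MS_sum right_half_plane (fun k => a n / (n`!)%:R * k ^+ n)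
            (alpha + 1) beta)) /\
        MS_sum right_half_plane f (alpha + 1) beta =
          \sum_(1 <= m < M.+1)
             MS_sum right_half_plane (fun k => b m * k ^- m) (alpha + 1) beta
          + limn (series (fun n =>
              MS_sum right_half_plane (fun k => a n / (n`!)%:R * k ^+ n)
                (alpha + 1) beta))].
Proof.
have [p [[_ hpos hneg _] hder hs]] := hp.
have sa : cvgn (series (fun n => (2 * pi) ^- n * modulus (a n))).
  apply: cvgn_of_nneseries_lty hs => n.
  by rewrite mulr_ge0 ?modulus_ge0// invr_ge0 exprn_ge0// ltW// mul2pi_gt0.
have hf' z : right_half_plane z -> f z = \sum_(1 <= m < M.+1) b m * z ^- m + egf a z.
  by move=> /hf[].
have /choice[Qm hQm] : forall m : nat, exists Q : Cplx R -> Cplx R, (0 < m)%N ->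
    MS_realizes right_half_plane (fun k => b m * k ^- m) (fun=> 0) Q.
  (* The value at [m = 0] is a dummy; the sums over [m] start at 1. *)
  move=> [|m]; first by exists (fun=> 0).
  by have [Q hQ] := MS_realizes_invpow (b m.+1) (ltn0Sn m); exists Q.
have hF := MS_realizes_sum sa hf' hpos hneg hder hQm.
split.
- by eexists; eexists; exact: hF.
- by move=> m /andP[m1 _]; eexists; eexists; exact: hQm.
- by move=> n; have [P hP] := MS_realizes_monomial n (a n); exists P; eexists; exact: hP.
move=> alpha beta halpha hbeta.
have Ha : right_half_plane (alpha + 1) by rewrite /right_half_plane /= ReD /= -ltrBlDr sub0r.
have Hb : right_half_plane (beta + 1) by rewrite /right_half_plane /= ReD /= -ltrBlDr sub0r.
pose E y n := a n * (euler_poly R n).[y + 2^-1].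
have MSn n : MS_sum right_half_plane (fun k => a n / n`!%:R * k ^+ n) (alpha + 1) beta =
    E beta n - E alpha n.
  have [P hP] := MS_realizes_monomial n (a n).
  by rewrite (MS_sumE hP Ha Hb) addrK.
(* Each monomial sum is a difference of two values of the same polynomial, so convergence of the
   series of sums reduces to that of [entire_sum] at [beta] and at [alpha]. *)
have lim : series (fun n => MS_sum right_half_plane (fun k => a n / n`!%:R * k ^+ n) (alpha + 1) beta)
    @ \oo --> entire_sum a beta - entire_sum a alpha.
  have e n : series (fun n => E beta n) n - series (fun n => E alpha n) n =
      series (fun n => MS_sum right_half_plane (fun k => a n / n`!%:R * k ^+ n) (alpha + 1) beta) n.
    by rewrite /series /= -sumrB; apply: eq_bigr => i _; rewrite MSn.
  exact: cvg_congr e erefl (cvgB (@cvg_entire_sum R a sa beta) (@cvg_entire_sum R a sa alpha)).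
split; first by apply/cvg_ex; eexists; exact: lim.
rewrite (cvg_lim _ lim)// (MS_sumE hF Ha Hb) addrK opprD addrACA -sumrB; congr (_ + _).
apply: eq_big_nat => m /andP[m1 _].
by rewrite (MS_sumE (hQm m m1) Ha Hb) addrK.
Qed.
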